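(* Let $1\le k<k'$ be natural numbers, let $\left(V_{[k']},\mathcal{B}_{\bar n},\mu_{\bar n}\right)_{\bar n\in\mathbb{N}^{k'}}$ be a $k'$-partite graded probability space, and let $f:\prod_{i\in[k']}V_i\to[0,1]$ be a $\mathcal{B}_{\bar 1^{k'}}$-measurable function with $\operatorname{VC}_k(f)<\infty$. Then $f$ is $\mathcal{B}_{\bar 1^{k'},k}$-measurable. More precisely, for every $\varepsilon>0$ there exist $N\in\mathbb{N}$, rationals $\gamma_i\in\mathbb{Q}\cap[0,1]$ for $i\in[N]$, and, for each $i\in[N]$ and each $I\subseteq[k']$ with $|I|\le k$, a $\mathcal{B}_I(f)$-measurable function $f^i_I:\prod_{j\in I}V_j\to[0,1]$, such that the function $g:\prod_{i\in[k']}V_i\to[0,1]$, $$g(\bar x):=\sum_{i\in[N]}\gamma_i\cdot\prod_{I\subseteq[k'],\,|I|\le k}f^i_I(\bar x_I),$$ satisfies $\|f-g\|_{L^2(\mu_{\bar 1^{k'}})}<\varepsilon$. (Here $\bar x_I=(x_i)_{i\in I}$.)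
   Context: Graded probability spaces. Fix $m\ge1$ and sets $V_1,\dots,V_m$. For $\bar n=(n_1,\dots,n_m)\in\mathbb{N}^m$ write $V^{\bar n}=\prod_{i\in[m]}V_i^{n_i}$, with elements $(\bar v_1,\dots,\bar v_m)$, $\bar v_i\in V_i^{n_i}$. For $\bar v\in V^{\bar n},\bar w\in V^{\bar n'}$ the ordered concatenation is $\bar v\oplus\bar w=(\bar v_1,\bar w_1,\dots,\bar v_m,\bar w_m)\in V^{\bar n+\bar n'}$. An $m$-partite graded probability space $(V_{[m]},\mathcal{B}_{\bar n},\mu_{\bar n})_{\bar n\in\mathbb{N}^m}$ consists of, for every $\bar n$, a $\sigma$-algebra $\mathcal{B}_{\bar n}$ of subsets of $V^{\bar n}$ and a probability measure $\mu_{\bar n}$ on it, such that: (symmetry) permuting coordinates inside a single block $V_i^{n_i}$ maps $\mathcal{B}_{\bar n}$ onto itself and preserves $\mu_{\bar n}$; (products) if $B\in\mathcal{B}_{\bar n}$, $C\in\mathcal{B}_{\bar n'}$ then $\{\bar v\oplus\bar w:\bar v\in B,\bar w\in C\}\in\mathcal{B}_{\bar n+\bar n'}$; (Fubini) for $B\in\mathcal{B}_{\bar n+\bar n'}$ and $\bar w\in V^{\bar n'}$, the fiber $B_{\bar w}=\{\bar v:\bar v\oplus\bar w\in B\}$ is in $\mathcal{B}_{\bar n}$, $\bar w\mapsto\mu_{\bar n}(B_{\bar w})$ is $\mathcal{B}_{\bar n'}$-measurable, and $\mu_{\bar n+\bar n'}(B)=\int\mu_{\bar n}(B_{\bar w})\,d\mu_{\bar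 n'}(\bar w)$. $\bar 1^m=(1,\dots,1)$ and $\bar\delta_i$ is the tuple with $1$ in position $i$ and $0$ elsewhere; for $I\subseteq[m]$ the product $\prod_{i\in I}V_i$ is identified with $V^{\sum_{i\in I}\bar\delta_i}$ and carries $\mathcal{B}_{\sum_{i\in I}\bar\delta_i}$, $\mu_{\sum_{i\in I}\bar\delta_i}$. Cylinder algebras. For $\bar n$ with $n=\sum n_i$ and $t<n$, $\mathcal{B}_{\bar n,t}$ is the $\sigma$-subalgebra of $\mathcal{B}_{\bar n}$ generated by all sets $\{\bar x\in V^{\bar n}:((\bar x_1)_{I_1},\dots,(\bar x_m)_{I_m})\in X\}$ with $I_i\subseteq[n_i]$, $\sum_i|I_i|\le t$, $X\in\mathcal{B}_{|I_1|,\dots,|I_m|}$ (where $(\bar x_i)_{I_i}$ is the subtuple of $\bar x_i$ indexed by $I_i$). Algebras of fibers. For a $\mathcal{B}_{\bar 1^m}$-measurable $f:\prod_{i\in[m]}V_i\to[0,1]$ and $I\subseteq[m]$, $\mathcal{B}_I(f)$ is the $\sigma$-subalgebra of $\mathcal{B}_{\sum_{i\in I}\bar\delta_i}$ generated by all sets $\{\bar x\in\prod_{i\in I}V_i: f(\bar x\oplus\bar w_{[m]\setminus I})<q\}$, where $\bar w\in\prod_{i\in[m]}V_i$, $q$ ranges over dyadic rationals in $[0,1]$, and $\bar x\oplus\bar w_{[m]\setminus I}$ is the tuple whose coordinates in $I$ come from $\bar x$ and the others from $\bar w$. $\operatorname{VC}_k$-dimension of functions. For $h:\prod_{i\in[k+1]}W_i\to[0,1]$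 and $r<s$ in $[0,1]$, a box $A=A_1\times\dots\times A_k$, $A_i\subseteq W_i$, is $(r,s)$-shattered by $h$ if for every $S\subseteq A$ there is $c_S\in W_{k+1}$ with $h(\bar a,c_S)\le r$ for all $\bar a\in S$ and $h(\bar a,c_S)\ge s$ for all $\bar a\in A\setminus S$. For $\bar d=(d_{r,s})_{r<s\in[0,1]}$ with $d_{r,s}\in\mathbb{N}$, $\operatorname{VC}_k(h)\le\bar d$ means that for every $r<s$ no box with all $|A_i|=d_{r,s}$ is $(r,s)$-shattered by $h$. For $h$ of arity $k'>k+1$, $\operatorname{VC}_k(h)\le\bar d$ means that for every $I\subseteq[k']$ with $|I|=k'-(k+1)$ and every $\bar b\in\prod_{i\in I}W_i$, the $(k+1)$-ary fiber $h_{\bar b}$ on $\prod_{i\in[k']\setminus I}W_i$ (coordinates in increasing order) satisfies $\operatorname{VC}_k(h_{\bar b})\le\bar d$. $\operatorname{VC}_k(h)<\infty$ means $\operatorname{VC}_k(h)\le\bar d$ for some such $\bar d$.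
   Formalization: ''f is B_{1,k}-measurable'' is proved up to null sets (f equals almost everywhere a B_{1,k}-measurable function); literal measurability fails, e.g. for a null diagonal in B_{(1,1)} on an uncountable set with countably supported sets and k=1, k'=2. *)

(* Defs.v *)
From HB Require Import structures.
From mathcomp Require Import all_boot all_order all_fingroup all_algebra.
From mathcomp Require Import all_classical all_reals all_analysis.
From mathcomp Require Import measurable_realfun.

Set Implicit Arguments.
Unset Strict Implicit.
Unset Printing Implicit Defensive.

Import Order.TTheory GRing.Theory Num.Theory.
Import numFieldNormedType.Exports.

Local Open Scope classical_set_scope.
Local Open Scope card_scope.
Local Open Scope ring_scope.

(* [bpow V n] is V^n = \prod_i V_i^(n_i). The factors are pointed only because
   [measurableType] requires it; a set V_i carrying a probability measure is
   nonempty anyway. *)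
Definition bpow (m : nat) (V : 'I_m -> pointedType) (n : 'I_m -> nat) : Type :=
  forall i : 'I_m, 'I_(n i) -> V i.

Definition addm (m : nat) (n n' : 'I_m -> nat) : 'I_m -> nat :=
  fun i => (n i + n' i)%N.

Definition onesm (m : nat) : 'I_m -> nat := fun=> 1%N.

(* \sum_(i in I) delta_i; by definition \prod_(i in I) V_i is [bpow V (indm I)],
   whose i-th block is empty for i outside I and a single entry for i in I. *)
Definition indm (m : nat) (I : {set 'I_m}) : 'I_m -> nat :=
  fun i => nat_of_bool (i \in I).

Section Tuples.
Context (m : nat) (V : 'I_m -> pointedType).

Definition bcat (n n' : 'I_m -> nat) (v : bpow V n) (w : bpow V n') :
    bpow V (addm n n') :=
  fun i j => match fintype.split j with inl a => v i a | inr b => w i b end.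

Definition bperm (n : 'I_m -> nat) (s : forall i, 'S_(n i)) (v : bpow V n) :
    bpow V n :=
  fun i j => v i (s i j).

Definition bsub (n : 'I_m -> nat) (I : forall i, {set 'I_(n i)}) (x : bpow V n) :
    bpow V (fun i => #|I i|) :=
  fun i j => x i (enum_val j).

Definition btuple (x : bpow V (@onesm m)) : forall i, V i := fun i => x i ord0.

Definition brestr (I : {set 'I_m}) (x : forall i, V i) : bpow V (indm I) :=
  fun i _ => x i.

(* The tuple with coordinates in I taken from x, the others from w:
   [insub 0] is [Some _] in 'I_(i \in I) exactly when i \in I. *)
Definition bglue (I : {set 'I_m}) (x : bpow V (indm I)) (w : forall i, V i) :
    forall i, V i :=
  fun i => oapp (x i) (w i) (insub 0%N).

Lemma bglue_in (I : {set 'I_m}) (x : bpow V (indm I)) (w : forall i, V i)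
    (i : 'I_m) (j : 'I_(indm I i)) : bglue x w i = x i j.
Proof.
rewrite /bglue; case: insubP => [u _ u0|] /=.
  congr (x i _); apply: val_inj; rewrite /= u0.
  by move: j; rewrite /indm; case: (i \in I) => -[[|?] ?].
by rewrite -leqNgt => /leq_trans/(_ (leq0n j)); rewrite leqNgt (leq_ltn_trans _ (ltn_ord j)).
Qed.

Lemma bglue_out (I : {set 'I_m}) (x : bpow V (indm I)) (w : forall i, V i)
    (i : 'I_m) : i \notin I -> bglue x w i = w i.
Proof.
move=> iI; rewrite /bglue; case: insubP => //= u lt0 _.
by exfalso; move: lt0; rewrite /indm (negbTE iI).
Qed.

End Tuples.

Arguments bsub {m V n} I x.
Arguments brestr {m V} I x.

Unset Implicit Arguments.
Record graded_probability (R : realType) (m : nat) (V : 'I_m -> pointedType) :=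
GradedProbability {
  gB : forall n : 'I_m -> nat, set (set (bpow V n)) ;
  gB_sigma : forall n, sigma_algebra setT (gB n) ;
  gmu : forall n, probability (g_sigma_algebraType (gB n)) R ;
  (* [s] permutes the block V_i^(n_i) only *)
  g_symB : forall (n : 'I_m -> nat) (i : 'I_m) (s : forall j, 'S_(n j)),
    (forall j : 'I_m, j != i -> s j = 1%g) ->
    [set bperm s @` B | B in gB n] = gB n ;
  g_symmu : forall (n : 'I_m -> nat) (i : 'I_m) (s : forall j, 'S_(n j)),
    (forall j : 'I_m, j != i -> s j = 1%g) ->
    forall B, gB n B -> gmu n (bperm s @` B) = gmu n B ;
  g_prod : forall n n' (B : set (bpow V n)) (C : set (bpow V n')), gB n B -> gB n' C ->
    gB (addm n n') [set bcat v w | v in B & w in C] ;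
  g_fiber : forall n n' (B : set (bpow V (addm n n'))), gB (addm n n') B ->
    forall w : bpow V n', gB n [set v | B (bcat v w)] ;
  g_fiber_meas : forall n n' (B : set (bpow V (addm n n'))), gB (addm n n') B ->
    measurable_fun [set: g_sigma_algebraType (gB n')]
      (fun w => gmu n [set v | B (bcat v w)]) ;
  g_Fubini : forall n n' (B : set (bpow V (addm n n'))), gB (addm n n') B ->
    gmu (addm n n') B = (\int[gmu n']_w gmu n [set v | B (bcat v w)])%E
}.
Arguments graded_probability R {m} V.
Arguments gB {R m V} _ n.
Arguments gmu {R m V} _ n.
Set Implicit Arguments.

Section Algebras.
Context (R : realType) (m : nat) (V : 'I_m -> pointedType).
Variable P : graded_probability R V.

(* Generators of the cylinder algebra B_(n,t). *)
Definition cylinders (n : 'I_m -> nat) (t : nat) : set (set (bpow V n)) :=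
  [set C | exists (I : forall i, {set 'I_(n i)}) (X : set (bpow V (fun i => #|I i|))),
    [/\ (\sum_i #|I i| <= t)%N, gB P _ X & C = [set x | X (bsub I x)]]].

Definition dyadic01 : set R :=
  [set q | exists a b : nat, (a <= 2 ^ b)%N /\ q = a%:R / 2 ^+ b].

(* Generators of the algebra of fibers B_I(f). *)
Definition fiber_sets (f : (forall i, V i) -> R) (I : {set 'I_m}) :
    set (set (bpow V (indm I))) :=
  [set C | exists (w : forall i, V i) (q : R),
    dyadic01 q /\ C = [set x | f (bglue x w) < q]].

End Algebras.

Arguments cylinders {R m V} P n t.
Arguments fiber_sets {R m V} f I.

(* h is measurable with respect to the sigma-algebra generated by G. *)
Definition gen_measurable (R : realType) (T : pointedType) (G : set (set T))
    (h : T -> R) : Prop :=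
  measurable_fun [set: g_sigma_algebraType G] h.

(* h agrees mu-almost everywhere with a function measurable with respect to the
   sigma-algebra generated by G. Exact measurability with respect to a cylinder
   algebra cannot be expected: on an uncountable set, the diagonal may be a null set
   of B_(1,1) lying outside the product of the algebras B_(1,0) and B_(0,1). *)
Definition gen_measurable_ae (R : realType) (T : pointedType) (B G : set (set T))
    (mu : probability (g_sigma_algebraType B) R) (h : T -> R) : Prop :=
  exists2 h' : T -> R, gen_measurable G h' & {ae mu, forall x, h x = h' x}.

Section VCk.
Context (R : realType).

(* The tuple (a, c) is quantified over as the unique x with x = a on the first k
   coordinates and x = c on the last one. *)
Definition shattered (k : nat) (W : 'I_k.+1 -> Type)
    (h : (forall i, W i) -> R) (r s : R)
    (A : forall i : 'I_k, set (W (lift ord_max i))) : Prop :=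
  let box := [set a : forall i : 'I_k, W (lift ord_max i) | forall i, A i (a i)] in
  forall S, S `<=` box ->
  exists c : W ord_max, forall x : forall i, W i, x ord_max = c ->
    let a := fun i : 'I_k => x (lift ord_max i) in
    (S a -> h x <= r) /\ ((box `\` S) a -> s <= h x).

Definition VC_le_succ (k : nat) (W : 'I_k.+1 -> Type) (h : (forall i, W i) -> R)
    (d : R -> R -> nat) : Prop :=
  forall r s : R, 0 <= r -> r < s -> s <= 1 ->
  forall A : forall i : 'I_k, set (W (lift ord_max i)),
    (forall i, A i #= `I_(d r s)) -> ~ shattered h r s A.

Section Fiber.
Context (k m : nat) (I : {set 'I_m}) (cI : (#|I| + k.+1 = m)%N).

Lemma card_free : #|~: I| = k.+1.
Proof.
by apply: (@addnI #|I|); rewrite cardsC card_ord cI.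
Qed.

(* Increasing enumeration of the complement of I. *)
Definition free_coord (j : 'I_k.+1) : 'I_m := enum_val (cast_ord (esym card_free) j).

Definition free_rank (i : 'I_m) (iI : i \in ~: I) : 'I_k.+1 :=
  cast_ord card_free (enum_rank_in iI i).

Lemma free_rankK (i : 'I_m) (iI : i \in ~: I) : free_coord (free_rank iI) = i.
Proof. by rewrite /free_coord /free_rank cast_ordK enum_rankK_in. Qed.

Lemma free_coordK (j : 'I_k.+1) (jI : free_coord j \in ~: I) : free_rank jI = j.
Proof. by rewrite /free_rank /free_coord enum_valK_in cast_ordKV. Qed.

Lemma free_coord_notin (j : 'I_k.+1) : free_coord j \notin I.
Proof. by have := enum_valP (cast_ord (esym card_free) j); rewrite inE. Qed.

Lemma free_coord_lt (j j' : 'I_k.+1) : (j < j')%N -> (free_coord j < free_coord j')%N.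
Proof.
move=> jj'; rewrite /free_coord.
have x0 : 'I_m := enum_val (cast_ord (esym card_free) j).
rewrite !(enum_val_nth x0).
have srt : sorted (relpre val ltn) (enum (~: I)).
  have -> : enum (~: I) = [seq i <- enum 'I_m | i \in ~: I] by rewrite enumT.
  apply: sorted_filter.
    by move=> a b c; apply: ltn_trans.
  by rewrite -sorted_map val_enum_ord iota_ltn_sorted.
apply: (sorted_ltn_nth (leT := relpre val ltn) _ x0 srt) => //.
- by move=> a b c; apply: ltn_trans.
- by rewrite inE -cardE; apply: ltn_ord.
- by rewrite inE -cardE; apply: ltn_ord.
Qed.

Variable W : 'I_m -> Type.

Definition merge (b : forall i, i \in I -> W i) (y : forall j, W (free_coord j)) :
    forall i, W i :=
  fun i => match decP (@idP (i \in I)) with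
  | left iI => b i iI
  | right iI =>
      ecast i (W i) (free_rankK (etrans (finset.in_setC i I) (introN idP iI))) (y _)
  end.

Lemma merge_in b y i (iI : i \in I) : merge b y i = b i iI.
Proof.
rewrite /merge; case: (decP _) => [iI'|//].
by rewrite (bool_irrelevance iI' iI).
Qed.

Lemma merge_free b y j : merge b y (free_coord j) = y j.
Proof.
rewrite /merge; case: (decP _) => [jI|jI].
  by have := free_coord_notin j; rewrite jI.
move: (etrans _ _) => jI'; move: (free_rankK jI').
move: (free_coordK jI'); move: (free_rank jI') => j'' -> e.
by rewrite (eq_irrelevance e erefl).
Qed.

Definition fiber_fun (h : (forall i, W i) -> R) (b : forall i, i \in I -> W i)
    (y : forall j, W (free_coord j)) : R :=
  h (merge b y).

End Fiber.

(* For m = k + 1 the only I is the empty set and the only fiber is h itself. *)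
Definition VC_le (k m : nat) (W : 'I_m -> Type) (h : (forall i, W i) -> R)
    (d : R -> R -> nat) : Prop :=
  forall (I : {set 'I_m}) (cI : (#|I| + k.+1 = m)%N) (b : forall i, i \in I -> W i),
    VC_le_succ (fiber_fun (cI := cI) h b) d.

Definition VC_finite (k m : nat) (W : 'I_m -> Type) (h : (forall i, W i) -> R) : Prop :=
  exists d : R -> R -> nat, VC_le k h d.

End VCk.

(* Main.v *)
(* Call [C_t] the sigma-algebra generated by the fibers of [f] in at most [t]
   coordinates. For a set [A], its hull in [C_t] is the smallest element of [C_t]
   containing [A] up to null sets. Let [f'] be a fiber of [f] in [t+1 > k] coordinates.
   If for some dyadic [r < s] the hulls of [{f' < r}] and [{f' >= s}] meet in a set [W]
   of positive measure, then so does a blow-up of [W] (every coordinate replaced by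
   many copies, all edges required to lie in [W]). Two distinct edges share at most [t]
   of the relevant coordinates, so once the vertices outside an edge are frozen, the
   condition imposed by any other edge is a [C_t]-set in that edge; by Fubini, the hulls
   can therefore be replaced by the original sets, one edge at a time, without losing
   positivity. A point of the resulting set exhibits an [(r,s)]-shattered box,
   contradicting the VC_k bound. Hence sublevel sets of fibers in [t+1] coordinates lie
   in [C_t] up to null sets, and, descending, the sublevel sets of [f] lie in [C_k].
   The L^2 statement follows by approximating finitely many of them by elements of the
   algebra generated by the fibers, whose indicators are sums of products. *)
Require Import Defs.
From mathcomp Require Import all_boot all_order all_fingroup all_algebra.
From mathcomp Require Import all_classical all_reals all_analysis.
From mathcomp Require Import measurable_realfun.
Import Order.TTheory GRing.Theory Num.Theory.
Import numFieldNormedType.Exports.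
Local Open Scope classical_set_scope.
Local Open Scope ring_scope.

Set Implicit Arguments.
Unset Strict Implicit.
Unset Printing Implicit Defensive.

(** * Coordinate selections in a graded probability space *)

Lemma split_lshift (m n : nat) (i : 'I_m) : fintype.split (lshift n i) = inl i.
Proof. exact: (unsplitK (inl i)). Qed.

Lemma split_rshift (m n : nat) (i : 'I_n) : fintype.split (rshift m i) = inr i.
Proof. exact: (unsplitK (inr i)). Qed.

Section SigmaAlgebra.
Context (T : Type) (C : set (set T)) (sC : sigma_algebra setT C).

Lemma salgC A : C A -> C (~` A).
Proof. by case: sC => _ + _ => /[apply]; rewrite setTD. Qed.

Lemma salgT : C setT.
Proof. by rewrite -setC0; apply: salgC; case: sC. Qed.

Lemma salgI A B : C A -> C B -> C (A `&` B).
Proof.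
move=> CA CB; rewrite -[_ `&` _]setCK setCI -bigcup2E.
apply: salgC; case: sC => C0 _; apply => -[|[|]]//=; exact: salgC.
Qed.

Lemma salg_bigcap (F : (set T)^nat) : (forall k, C (F k)) -> C (\bigcap_k F k).
Proof.
move=> CF; rewrite -[\bigcap_k _]setCK setC_bigcap; apply: salgC.
by case: sC => _ _; apply => k; exact: salgC.
Qed.

Lemma salg_forall (Q : finType) (p : pred Q) (F : Q -> set T) :
  (forall q, p q -> C (F q)) -> C [set x | forall q, p q -> F q x].
Proof.
move=> CF; suff H (s : seq Q) : {subset s <= p} ->
    C [set x | forall q, q \in s -> F q x].
  have := H (enum p); rewrite (_ : [set x | forall q, q \in _ -> _] =
    [set x | forall q, p q -> F q x]); first by apply=> q; rewrite mem_enum.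
  by apply/funext => x /=; rewrite propeqE;
     split=> Fx q pq; apply: Fx; move: pq; rewrite mem_enum.
elim: s => [_|q s IH sp].
  by rewrite (_ : [set _ | _] = setT); [exact: salgT|apply/seteqP; split].
rewrite (_ : [set _ | _] = F q `&` [set x | forall q, q \in s -> F q x]).
  apply: salgI; first by apply: CF; apply: sp; rewrite inE eqxx.
  by apply: IH => q' q's; apply: sp; rewrite inE q's orbT.
apply/seteqP; split=> x /=.
  move=> Fx; split; first by apply: Fx; rewrite inE eqxx.
  by move=> q' q's; apply: Fx; rewrite inE q's orbT.
by move=> [Fq Fs] q'; rewrite inE => /orP[/eqP ->|/Fs].
Qed.

End SigmaAlgebra.

Section Selections.
Context (R : realType) (m : nat) (V : 'I_m -> pointedType).
Variable P : graded_probability R V.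
Implicit Types n p : 'I_m -> nat.

Lemma gB_measurable n (A : set (bpow V n)) :
  measurable (A : set (g_sigma_algebraType (gB P n))) = gB P n A.
Proof.
rewrite /measurable/=.
by rewrite sigma_algebra_id//; exact: gB_sigma.
Qed.

(** Block permutations, subtuples and projections are all of this form, and so is the overwriting of
    coordinates, read as a selection from a concatenation. One lemma, [bsel_preimage], then gives
    measurability and measure for all of them. *)
Definition bsel n n' (s : forall i, 'I_(n' i) -> 'I_(n i)) (x : bpow V n) :
  bpow V n' := fun i j => x i (s i j).

Lemma bperm_block_preimage n (i : 'I_m) (s : forall j, 'S_(n j)) B :
  (forall j, j != i -> s j = 1%g) -> gB P n B ->
  gB P n (bperm s @^-1` B) /\ gmu P n (bperm s @^-1` B) = gmu P n B.
Proof.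
move=> s1 nB; pose t j := (s j)^-1%g.
have t1 j : j != i -> t j = 1%g by move=> /s1 e; rewrite /t e invg1.
have <- : bperm t @` B = bperm s @^-1` B.
  apply/seteqP; split=> [_ [x Bx <-]|x Bx].
    rewrite /=; suff -> : bperm s (bperm t x) = x by [].
    by apply: functional_extensionality_dep => j; apply/funext => a;
       rewrite /bperm /t permK.
  exists (bperm s x) => //.
  by apply: functional_extensionality_dep => j; apply/funext => a;
     rewrite /bperm /t permKV.
split; last exact: (@g_symmu _ _ _ P n i t t1).
by rewrite -(@g_symB _ _ _ P n i t t1); exists B.
Qed.

(** [t l] permutes only the blocks below [l]; passing to [l.+1] costs one use of the single-block
    symmetry. *)
Lemma bperm_preimage n (s : forall j, 'S_(n j)) B : gB P n B ->
  gB P n (bperm s @^-1` B) /\ gmu P n (bperm s @^-1` B) = gmu P n B.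
Proof.
move=> nB; pose t (l : nat) (j : 'I_m) := if (j < l)%N then s j else 1%g.
suff H l : (l <= m)%N ->
    gB P n (bperm (t l) @^-1` B) /\ gmu P n (bperm (t l) @^-1` B) = gmu P n B.
  have -> : s = t m; last exact: H.
  by apply: functional_extensionality_dep => j; rewrite /t ltn_ord.
elim: l => [_|l IH lm].
  have -> : bperm (t 0%N) @^-1` B = B; last by split.
  rewrite /preimage; apply/funext => x /=; congr B.
  by apply: functional_extensionality_dep => j; apply/funext => a;
     rewrite /bperm /t perm1.
have [IHB IHmu] := IH (ltnW lm).
pose u j := if j == Ordinal lm then s j else 1%g.
have u1 j : j != Ordinal lm -> u j = 1%g by rewrite /u => /negbTE ->.
have [uB umu] := bperm_block_preimage u1 IHB.
have -> : bperm (t l.+1) @^-1` B = bperm u @^-1` (bperm (t l) @^-1` B).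
  rewrite /preimage; apply/funext => x /=; congr B.
  apply: functional_extensionality_dep => j; apply/funext => a; rewrite /bperm /t /u.
  rewrite ltnS leq_eqVlt -val_eqE /=.
  by case: (eqVneq (j : nat) l) => [->|]/=; rewrite ?ltnn ?perm1//; case: ifP.
by rewrite umu.
Qed.

(** The complements of the ranges of [lshift n] and of [s] have the same cardinality and are matched
    through their enumerations. The last branch in [f] is a dummy, ruled out by [rA]. *)
Lemma extend_injection (k n : nat) (s : 'I_k -> 'I_(k + n)) : injective s ->
  exists t : 'S_(k + n), forall j, t (lshift n j) = s j.
Proof.
move=> s_inj.
have : #|~: (lshift n @: 'I_k)%SET| = #|~: (s @: 'I_k)%SET|.
  rewrite cardsCs [RHS]cardsCs !finset.setCK !card_imset//; exact: lshift_inj.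
set A := ~: _; set B := ~: _ => AB.
pose f (x : 'I_(k + n)) := match fintype.split x with
  | inl a => s a
  | inr b => match decP (@idP (rshift k b \in A)) with
     | left h => enum_val (cast_ord AB (enum_rank_in h (rshift k b)))
     | right _ => x end
  end.
have rA b : rshift k b \in A.
  rewrite inE; apply/imsetP => -[j _ /(congr1 fintype.split)].
  by rewrite split_lshift split_rshift.
have f_inj : injective f.
  move=> x y; rewrite -(splitK x) -(splitK y) /f !unsplitK.
  case: (fintype.split x) => a; case: (fintype.split y) => b.
  - by move=> /s_inj ->.
  - case: decP => [h|]; last by rewrite rA.
    move: (enum_valP (cast_ord AB (enum_rank_in h (rshift k b)))) => + e.
    by rewrite -e inE imset_f.
  - case: decP => [h|]; last by rewrite rA.
    move: (enum_valP (cast_ord AB (enum_rank_in h (rshift k a)))) => + e.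
    by rewrite e inE imset_f.
  - case: decP => [h|]; last by rewrite rA.
    case: decP => [h'|]; last by rewrite rA.
    move=> /enum_val_inj /cast_ord_inj e.
    have := congr1 enum_val e; rewrite !enum_rankK_in ?rA//.
exists (perm f_inj) => j; by rewrite permE /f split_lshift.
Qed.

(** Extend [s] to a permutation: the selection becomes this permutation followed by the projection
    to the first coordinates. By Fubini the cylinder [C] over [B] has the measure of [B], since all
    its fibers equal [B]. *)
Lemma bsel_preimage n n' (s : forall i, 'I_(n' i) -> 'I_(n i)) B :
  (forall i, injective (s i)) -> gB P n' B ->
  gB P n (bsel s @^-1` B) /\ gmu P n (bsel s @^-1` B) = gmu P n' B.
Proof.
move=> s_inj nB.
have le i : (n' i <= n i)%N.
  by rewrite -[n' i]card_ord -[n i]card_ord; exact: leq_card (s_inj i).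
have [n'' en] : exists n'', n = addm n' n''.
  by exists (fun i => n i - n' i)%N; apply/funext => i; rewrite /addm subnKC.
subst n.
have [t ts] : exists t : forall i, 'S_(n' i + n'' i), forall i j,
   t i (lshift (n'' i) j) = s i j.
  have H i : exists t : 'S_(n' i + n'' i), forall j, t (lshift (n'' i) j) = s i j.
    exact: (@extend_injection (n' i) (n'' i) (s i) (s_inj i)).
  by exists (fun i => projT1 (cid (H i))) => i j; rewrite (projT2 (cid (H i))).
pose C := [set bcat v w | v in B & w in [set: bpow V n'']].
have CE : C = bsel (n := addm n' n'') (fun i j => lshift (n'' i) j) @^-1` B.
  apply/seteqP; split => [_ [v Bv [w _ <-]]|x Bx] /=.
    suff -> : bsel (n := addm n' n'') (fun i j => lshift (n'' i) j) (bcat v w) = v by [].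
    by apply: functional_extensionality_dep => j; apply/funext => a;
       rewrite /bsel /bcat split_lshift.
  exists (bsel (n := addm n' n'') (fun i j => lshift (n'' i) j) x) => //.
  exists (bsel (n := addm n' n'') (fun i j => rshift (n' i) j) x) => //.
  apply: functional_extensionality_dep => j; apply/funext => a.
  by rewrite /bcat /bsel; case: split_ordP => b ->.
have CB : gB P (addm n' n'') C.
  apply: g_prod => //; rewrite -gB_measurable; exact: measurableT.
have Cmu : gmu P _ C = gmu P n' B.
  rewrite g_Fubini//.
  under eq_integral => w _.
    rewrite (_ : [set v | C (bcat v w)] = B); last first.
      apply/funext => v; rewrite CE /preimage /=; congr B.
      by apply: functional_extensionality_dep => j; apply/funext => a;
         rewrite /bsel /bcat split_lshift.
    over.
  by rewrite integral_cst//= probability_setT mule1.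
have -> : bsel s @^-1` B = bperm t @^-1` C.
  rewrite CE /preimage; apply/funext => x /=; congr B.
  by apply: functional_extensionality_dep => j; apply/funext => a;
     rewrite /bsel /bperm ts.
by rewrite -Cmu; exact: bperm_preimage.
Qed.

Definition charged n n' (B : set (bpow V (addm n n'))) : set (bpow V n') :=
  [set w | gmu P n [set v | B (bcat v w)] != 0%E].

Lemma charged_meas n n' (B : set (bpow V (addm n n'))) :
  gB P (addm n n') B -> gB P n' (charged B).
Proof.
move=> nB; rewrite -gB_measurable /charged.
have := emeasurable_neq measurableT (@g_fiber_meas _ _ _ P n n' B nB) 0%E.
by rewrite setTI.
Qed.

(** Fubini, and the fact that a nonnegative function has integral zero exactly when it vanishes
    almost everywhere. *)
Lemma fiber_null n n' (B : set (bpow V (addm n n'))) : gB P (addm n n') B ->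
  gmu P _ B = 0%E <-> gmu P n' (charged B) = 0%E.
Proof.
move=> nB; have mE := charged_meas nB.
rewrite -gB_measurable in mE; rewrite -(negligibleP _ mE) g_Fubini//.
have -> : (\int[gmu P n']_w gmu P n [set v | B (bcat v w)] =
    \int[gmu P n']_w `|gmu P n [set v | B (bcat v w)]|)%E.
  by apply: eq_integral => w _; rewrite gee0_abs.
rewrite (ae_eq_integral_abs _ measurableT (@g_fiber_meas _ _ _ P n n' B nB)).
rewrite /ae_eq /almost_everywhere /prop_near1 /nbhs /=.
set X := ~` _; suff -> : X = charged B by [].
apply/funext => w; rewrite /X /charged /= propeqE; split.
  by move=> H; apply/eqP => e; apply: H => _.
by move=> /eqP H H'; apply: H; exact: H'.
Qed.

(** [upd a v w] overwrites by [v] the coordinates of [w] in the range of [a]; [upd_sel] writes this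
    as an injective selection from [bcat v w]. *)
Definition upd_sel p n (a : forall i, 'I_(p i) -> 'I_(n i)) (i : 'I_m)
    (j : 'I_(n i)) : 'I_(addm p n i) :=
  if [pick l | a i l == j] is Some l then lshift (n i) l else rshift (p i) j.

Definition upd p n (a : forall i, 'I_(p i) -> 'I_(n i)) (v : bpow V p)
    (w : bpow V n) : bpow V n :=
  fun i j => if [pick l | a i l == j] is Some l then v i l else w i j.

Lemma upd_sel_inj p n (a : forall i, 'I_(p i) -> 'I_(n i)) i :
  injective (@upd_sel p n a i).
Proof.
move=> j j'; rewrite /upd_sel.
case: pickP => [l /eqP <-|_]; case: pickP => [l' /eqP <-|_].
- by move=> /lshift_inj ->.
- by move=> /(congr1 fintype.split); rewrite split_lshift split_rshift.
- by move=> /(congr1 fintype.split); rewrite split_lshift split_rshift.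
- exact: rshift_inj.
Qed.

Lemma bsel_bcat p n (a : forall i, 'I_(p i) -> 'I_(n i)) (v : bpow V p)
    (w : bpow V n) : bsel (@upd_sel p n a) (bcat v w) = upd a v w.
Proof.
apply: functional_extensionality_dep => i; apply/funext => j.
rewrite /bsel /bcat /upd_sel /upd.
by case: pickP => [l _|_]; rewrite ?split_lshift ?split_rshift.
Qed.

Section Update.
Context p n (a : forall i, 'I_(p i) -> 'I_(n i)).

Lemma upd_fiber Z : gB P n Z -> forall w, gB P p [set v | Z (upd a v w)].
Proof.
move=> nZ w; have [sB _] := bsel_preimage (@upd_sel_inj p n a) nZ.
have := @g_fiber _ _ _ P _ _ _ sB w; congr gB.
by apply/funext => v /=; rewrite bsel_bcat.
Qed.

Definition upd_charged Z : set (bpow V n) :=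
  [set w | gmu P p [set v | Z (upd a v w)] != 0%E].

Lemma upd_chargedE Z : upd_charged Z = charged (bsel (@upd_sel p n a) @^-1` Z).
Proof.
apply/funext => w; rewrite /charged /upd_charged /=.
congr (is_true (gmu P p _ != 0%E)); apply/funext => v /=.
by rewrite bsel_bcat.
Qed.

Lemma upd_charged_meas Z : gB P n Z -> gB P n (upd_charged Z).
Proof.
move=> nZ; have [sB _] := bsel_preimage (@upd_sel_inj p n a) nZ.
by rewrite upd_chargedE; exact: charged_meas.
Qed.

(** For independent [v] and [w] the point [upd a v w] has law [gmu P n]. So [Z] is null iff, for
    almost every [w], resampling the coordinates selected by [a] almost never lands in [Z]. *)
Lemma upd_null Z : gB P n Z ->
  gmu P n Z = 0%E <-> gmu P n (upd_charged Z) = 0%E.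
Proof.
move=> nZ; have [sB <-] := bsel_preimage (@upd_sel_inj p n a) nZ.
by rewrite upd_chargedE; exact: fiber_null.
Qed.

End Update.
End Selections.

(** * Hulls and blow-ups *)

Section Hull.
Context d (T : measurableType d) (R : realType) (mu : probability T R).
Context (C : set (set T)) (sC : sigma_algebra setT C).
Context (Cm : C `<=` measurable).

(* [H] is a smallest set of [C] containing [A], up to null sets. *)
Definition is_hull (A H : set T) :=
  [/\ C H, mu (A `\` H) = 0%E &
      forall D, C D -> mu (A `&` D) = 0%E -> mu (H `&` D) = 0%E].

(** Minimise the measure among the sets of [C] that cover [A] up to a null set; the intersection of
    a minimising sequence attains the infimum. *)
Lemma hull_exists A : measurable A -> exists H, is_hull A H.
Proof.
move=> mA.
pose S := [set x | exists H, [/\ C H, mu (A `\` H) = 0%E & x = fine (mu H)]].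
have S_inf : has_inf S.
  split.
    exists (fine (mu setT)), setT; split=> //; first exact: salgT.
    by rewrite setDT measure0.
  by exists 0 => _ [H [_ _ ->]]; exact: fine_ge0.
have fmu H : C H -> (fine (mu H))%:E = mu H.
  by move=> /Cm mH; rewrite fineK// fin_num_measure.
have [F FS] : exists F : (set T)^nat, forall n,
    [/\ C (F n), mu (A `\` F n) = 0%E & fine (mu (F n)) < inf S + n.+1%:R^-1].
  have H n : exists B, [/\ C B, mu (A `\` B) = 0%E &
      fine (mu B) < inf S + n.+1%:R^-1].
    have [|_ [B [CB AB ->]] lt] := @inf_adherent _ S n.+1%:R^-1 _ S_inf.
      by rewrite invr_gt0.
    by exists B.
  by exists (fun n => projT1 (cid (H n))) => n; exact: (projT2 (cid (H n))).
have mF n : measurable (F n) by apply: Cm; case: (FS n).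
pose H := \bigcap_n F n.
have CH : C H by apply: salg_bigcap => // n; case: (FS n).
have mH := Cm CH.
have AH : mu (A `\` H) = 0%E.
  rewrite -negligibleP; last exact: measurableD.
  rewrite setDE setC_bigcap setI_bigcupr.
  apply: negligible_bigcup => n; apply/negligibleP.
    by apply: measurableI => //; exact: measurableC.
  by rewrite -setDE; case: (FS n).
exists H; split=> // D CD AD.
have mD := Cm CD.
have muH : fine (mu H) <= inf S.
  apply/ler_addgt0Pr => e e0.
  have [n ne] : exists n : nat, n.+1%:R^-1 < e.
    by have [n _ /(_ n (leqnn _))/=] := near_infty_natSinv_lt (PosNum e0); exists n.
  apply: le_trans (_ : fine (mu (F n)) <= _).
    by apply: fine_le; rewrite ?fin_num_measure// le_measure ?inE//; exact: bigcap_inf.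
  case: (FS n) => _ _ /ltW /le_trans; apply.
  by rewrite lerD2l ltW.
(* If [D] is null on [A], then removing [D] from [H] leaves a competitor, so [H] loses no
   measure. *)
have : inf S <= fine (mu (H `\` D)).
  apply: ge_inf; first by case: S_inf.
  exists (H `\` D); split=> //.
    by rewrite setDE; apply: salgI => //; exact: salgC.
  have -> : A `\` (H `\` D) = (A `\` H) `|` (A `&` D).
    by rewrite setDDr.
  rewrite measureU0 //; [exact: measurableD|exact: measurableI].
move=> /(le_trans muH).
have -> : mu H = (mu (H `\` D) + mu (H `&` D))%E by rewrite (measureDI mu mH mD).
have [mHD mHI] : measurable (H `\` D) /\ measurable (H `&` D).
  by split; [exact: measurableD|exact: measurableI].
rewrite fineD ?fin_num_measure// gerDl => le0.
apply/eqP; rewrite eq_le measure_ge0 andbT -(@fineK _ (mu _)) ?fin_num_measure//.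
Qed.

End Hull.

Section Blowup.
Context (R : realType) (m : nat) (V : 'I_m -> pointedType).
Variable P : graded_probability R V.
Implicit Types n p : 'I_m -> nat.

(** A point of [bpow V n] is read as [n i] vertices in each part [i]; an edge picks one vertex per
    part. *)
Definition edge n (e : forall i, 'I_(n i)) (x : bpow V n) : bpow V (@onesm m) :=
  fun i _ => x i (e i).

Lemma gmu_sub0 n (A B : set (bpow V n)) : gB P n A -> gB P n B -> A `<=` B ->
  gmu P n B = 0%E -> gmu P n A = 0%E.
Proof.
move=> nA nB AB; apply: subset_measure0 => //; by rewrite gB_measurable.
Qed.

Lemma gB_I n (A B : set (bpow V n)) : gB P n A -> gB P n B -> gB P n (A `&` B).
Proof. by apply: salgI; exact: gB_sigma. Qed.

Lemma gB_C n (A : set (bpow V n)) : gB P n A -> gB P n (~` A).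
Proof. by apply: salgC; exact: gB_sigma. Qed.

Section Vertex.
Context (n : 'I_m -> nat) (n_gt0 : forall i, (0 < n i)%N) (i0 : 'I_m).

(** One new vertex in part [i0]; [a] designates vertex 0 of that part as the one to be
    duplicated. *)
Let p (i : 'I_m) : nat := i == i0.
Let a i (_ : 'I_(p i)) : 'I_(n i) := Ordinal (n_gt0 i).

(** The fiber of [Z'] over [w] is nonnull iff [w] lies in [Z] and resampling its vertex 0 in part
    [i0] stays in [Z] with positive probability. The points of [Z] failing the second condition form
    a null set. *)
Lemma blowup_vertex Z : gB P n Z -> gmu P n Z <> 0%E ->
  let Z' : set (bpow V (addm p n)) :=
    [set x | Z (bsel (fun i j => rshift (p i) j) x) /\ Z (bsel (upd_sel a) x)] in
  gB P (addm p n) Z' /\ gmu P (addm p n) Z' <> 0%E.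
Proof.
move=> nZ muZ Z'.
have nZ' : gB P (addm p n) Z'.
  apply: gB_I.
    apply: (bsel_preimage _ nZ).1 => i; exact: rshift_inj.
  by apply: (bsel_preimage _ nZ).1 => i; exact: upd_sel_inj.
split=> // /(fiber_null nZ') Y0; apply: muZ.
have YE : charged P Z' = Z `&` upd_charged P a Z.
  apply/funext => w; rewrite /charged /upd_charged /= propeqE.
  have wE v : bsel (fun i j => rshift (p i) j) (bcat v w) = w.
    apply: functional_extensionality_dep => j; apply/funext => b.
    by rewrite /bsel /bcat split_rshift.
  have -> : [set v | Z' (bcat v w)] = [set v | Z w /\ Z (upd a v w)].
    by apply/funext => v; rewrite /Z' /= wE bsel_bcat.
  have [Zw|nZw] := pselect (Z w).
    have -> : [set v | Z w /\ Z (upd a v w)] = [set v | Z (upd a v w)].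
      by apply/funext => v /=; rewrite propeqE; split=> [[]|].
    by split=> [|[]].
  have -> : [set v | Z w /\ Z (upd a v w)] = set0.
    by apply/seteqP; split=> v // [].
  by rewrite measure0 eqxx; split=> // -[].
rewrite YE in Y0.
have nE := upd_charged_meas a nZ.
have nD : gB P n (Z `&` ~` upd_charged P a Z) by apply: gB_I => //; exact: gB_C.
have D0 : gmu P n (Z `&` ~` upd_charged P a Z) = 0%E.
  apply/(upd_null a nD); rewrite (_ : upd_charged _ _ _ = set0) ?measure0//.
  apply/seteqP; split=> w //; rewrite {1}/upd_charged /= => /eqP; apply.
  (* The condition [upd_charged P a Z] does not depend on the resampled coordinates. Hence
     resampling a charged [w] never meets the uncharged part of [Z], and resampling an uncharged [w]
     almost never meets [Z]. *)
  have updK v v' : upd a v' (upd a v w) = upd a v' w.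
    apply: functional_extensionality_dep => j; apply/funext => b.
    by rewrite /upd; case: pickP.
  have [cw|cw] := pselect (upd_charged P a Z w).
    rewrite (_ : [set v | _] = set0) ?measure0//; apply/seteqP; split=> v // [_] /=.
    apply; move: cw; rewrite /upd_charged /=.
    rewrite (_ : [set v' | Z (upd a v' (upd a v w))] = [set v' | Z (upd a v' w)])//.
    by apply/funext => v' /=; rewrite updK.
  apply: (@gmu_sub0 p _ [set v | Z (upd a v w)]).
  - exact: (upd_fiber a nD).
  - exact: (upd_fiber a nZ).
  - by move=> v [].
  - by apply: contrapT => /eqP.
rewrite -(setIT Z) -(setUv (upd_charged P a Z)) setIUr measureU0 //.
- by rewrite gB_measurable; exact: gB_I.
- by rewrite gB_measurable.
Qed.

(** An edge through the new vertex is an edge of the configuration in which that vertex replaces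
    vertex 0; any other edge is an edge of the old configuration. *)
Lemma blowup_edge (W : set (bpow V (@onesm m))) (Z : set (bpow V n)) :
  (forall x, Z x -> forall e, W (edge e x)) ->
  forall x : bpow V (addm p n), Z (bsel (fun i j => rshift (p i) j) x) ->
    Z (bsel (upd_sel a) x) -> forall e, W (edge e x).
Proof.
move=> ZW x Z1 Z2 e.
have p_eq i (l l' : 'I_(p i)) : l = l'.
  apply/val_inj; move: l l'; rewrite /p; case: (i == i0) => -[[|?] ?] [[|?] ?] //.
have p_i0 i (l : 'I_(p i)) : i = i0.
  by move: l; rewrite /p; case: eqP => // _ [].
pose e' i := match fintype.split (e i) with inl l => a l | inr j => j end.
have [[l el]|ne] := pselect (exists l, e i0 = lshift _ l).
  have := ZW _ Z2 (fun i =>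
    match fintype.split (e i) with inl l => a l | inr j => j end).
  congr W; apply: functional_extensionality_dep => i; apply/funext => j0.
  rewrite /edge /bsel; congr (x i _); rewrite /upd_sel.
  case: (split_ordP (e i)) => j eij; case: pickP => [l' _|].
  - by rewrite eij (p_eq _ l' j).
  - by move=> /(_ j); rewrite eqxx.
  - have ei := p_i0 _ l'; subst i; move: eij; rewrite el => /(congr1 fintype.split).
    by rewrite split_lshift split_rshift.
  - by rewrite eij.
have := ZW _ Z1 (fun i => match fintype.split (e i) with inl l => a l | inr j => j end).
congr W; apply: functional_extensionality_dep => i; apply/funext => j0.
rewrite /edge /bsel; congr (x i _).
case: (split_ordP (e i)) => j eij; last by rewrite eij.
by have ei := p_i0 _ j; subst i; exfalso; apply: ne; exists j.
Qed.

End Vertex.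

(** Induction on the total number of vertices, duplicating one vertex at a time; with a single
    vertex per part, [W] itself serves. *)
Lemma blowup (W : set (bpow V (@onesm m))) : gB P (@onesm m) W ->
  gmu P (@onesm m) W <> 0%E ->
  forall n, (forall i, (0 < n i)%N) -> exists Z : set (bpow V n),
    [/\ gB P n Z, gmu P n Z <> 0%E & forall x, Z x -> forall e, W (edge e x)].
Proof.
move=> mW muW n; have [k] := ubnP (\sum_i n i)%N.
elim: k n => // k IH n sum_n n_gt0.
have [[i0 n_i0]|n_le1] := pselect (exists i, (1 < n i)%N); last first.
  have -> : n = @onesm m.
    apply/funext => i; apply/eqP; rewrite eqn_leq n_gt0 andbT leqNgt.
    by apply/negP => ni; apply: n_le1; exists i.
  exists W; split=> // x Wx e; congr W: Wx.
  by apply: functional_extensionality_dep => i; apply/funext => j;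
     rewrite /edge (ord1 j) (ord1 (e i)).
pose p (i : 'I_m) : nat := i == i0.
pose n' i := (n i - p i)%N.
have n'_gt0 i : (0 < n' i)%N.
  by rewrite /n' /p subn_gt0; case: eqP => [->//|_]; exact: n_gt0.
have en : n = addm p n'.
  apply/funext => i; rewrite /addm /n' subnKC// /p.
  by case: eqP => // _; exact: n_gt0.
have sum_n' : (\sum_i n' i < k)%N.
  rewrite -ltnS; apply: leq_trans sum_n; rewrite ltnS en /addm big_split /=.
  rewrite -add1n leq_add2r (bigD1 i0)//= /p eqxx; exact: leq_addr.
have [Z [mZ muZ ZW]] := IH n' sum_n' n'_gt0.
have [mZ' muZ'] := blowup_vertex n'_gt0 i0 mZ muZ.
rewrite en; eexists; split; [exact: mZ'|exact: muZ'|].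
by move=> x [Z1 Z2]; exact: (blowup_edge ZW Z1 Z2).
Qed.

End Blowup.

(** * Replacing hulls by the original sets, one edge at a time *)

Section Counting.
Context (R : realType) (m : nat) (V : 'I_m -> pointedType).
Variable P : graded_probability R V.
Context (n : 'I_m -> nat).
Context (C : set (set (bpow V (@onesm m)))) (sC : sigma_algebra setT C).
Context (Cm : C `<=` gB P (@onesm m)).

(** Resampling of all vertices of the edge [e], the other vertices being frozen at [w]. *)
Let eupd (e : forall i, 'I_(n i)) :=
  @upd m V (@onesm m) n (fun i (_ : 'I_(@onesm m i)) => e i).

Lemma edge_upd (e : forall i, 'I_(n i)) v w : edge e (eupd e v w) = v.
Proof.
apply: functional_extensionality_dep => i; apply/funext => j.
rewrite /edge /eupd /upd; case: pickP => [l _|/(_ j)]; last by rewrite eqxx.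
by rewrite (ord1 l) (ord1 j).
Qed.

Lemma edge_meas (e : forall i, 'I_(n i)) A : gB P (@onesm m) A ->
  gB P n (edge e @^-1` A).
Proof.
move=> mA; have := bsel_preimage (P := P) (n := n)
  (s := fun i (_ : 'I_(@onesm m i)) => e i) _ mA.
by case=> // i j j' _; rewrite (ord1 j) (ord1 j').
Qed.

(** With the vertices off [e] frozen, [Z] becomes a set of [C]. The hull property then applies fiber
    by fiber, and [upd_null] integrates the result. *)
Lemma hull_step (e : forall i, 'I_(n i)) A H Z :
  gB P (@onesm m) A -> is_hull (gmu P (@onesm m)) C A H -> gB P n Z ->
  (forall w, C [set v | Z (eupd e v w)]) ->
  gmu P n (Z `&` edge e @^-1` A) = 0%E -> gmu P n (Z `&` edge e @^-1` H) = 0%E.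
Proof.
move=> mA [CH _ AH] mZ CZ.
have mH := Cm CH.
have mZA : gB P n (Z `&` edge e @^-1` A) by apply: gB_I => //; exact: edge_meas.
have mZH : gB P n (Z `&` edge e @^-1` H) by apply: gB_I => //; exact: edge_meas.
pose a i (_ : 'I_(@onesm m i)) := e i.
move=> /(upd_null a mZA) ZA0; apply/(upd_null a mZH).
apply: gmu_sub0 ZA0; [exact: upd_charged_meas|exact: upd_charged_meas|].
move=> w; rewrite /upd_charged /=.
have E B : [set v | (Z `&` edge e @^-1` B) (upd a v w)] =
    B `&` [set v | Z (eupd e v w)].
  apply/funext => v; rewrite /= propeqE; rewrite /preimage /= edge_upd.
  by split=> -[].
rewrite !E; apply: contra_neq; exact: AH.
Qed.

(** [X s] imposes [H] on the edges in [s] and [A] on the rest; [s] grows by one edge at a time. The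
    hypothesis on frozen sections covers both [A] and [H] because the other edges may be in either
    state. *)
Lemma counting (Q : finType) (e : Q -> forall i, 'I_(n i))
    (A H : Q -> set (bpow V (@onesm m))) :
  (forall q, gB P (@onesm m) (A q)) ->
  (forall q, is_hull (gmu P (@onesm m)) C (A q) (H q)) ->
  (forall q q', q' != q -> forall w,
     C [set v | A q' (edge (e q') (eupd (e q) v w))] /\
     C [set v | H q' (edge (e q') (eupd (e q) v w))]) ->
  gmu P n [set x | forall q, A q (edge (e q) x)] = 0%E ->
  gmu P n [set x | forall q, H q (edge (e q) x)] = 0%E.
Proof.
move=> mA AH Ce A0.
have mH q : gB P (@onesm m) (H q) by apply: Cm; case: (AH q).
pose X (s : seq Q) q := if q \in s then H q else A q.
have mX s q : gB P (@onesm m) (X s q) by rewrite /X; case: ifP.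
suff S s : gmu P n [set x | forall q, X s q (edge (e q) x)] = 0%E.
  have := S (enum Q); congr (gmu P n _ = _); apply/funext => x /=.
  by rewrite /X propeqE; split=> Hx q; have := Hx q; rewrite mem_enum.
elim: s => [//|q s IH].
have [qs|qs] := boolP (q \in s).
  move: IH; congr (gmu P n _ = _); apply/funext => x /=; rewrite /X propeqE.
  by split=> Hx q'; have := Hx q'; rewrite inE; case: eqP => // ->; rewrite qs.
pose Z : set (bpow V n) := [set x | forall q', q' != q -> X s q' (edge (e q') x)].
have mZ : gB P n Z.
  apply: (salg_forall (@gB_sigma _ _ _ P n) (p := fun q' => q' != q)
    (F := fun q' => edge (e q') @^-1` X s q')) => q' _; exact: edge_meas.
have CZ w : C [set v | Z (eupd (e q) v w)].
  apply: (salg_forall sC (p := fun q' => q' != q)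
    (F := fun q' => [set v | X s q' (edge (e q') (eupd (e q) v w))])) => q' q'q.
  by have [CA CH] := Ce q q' q'q w; rewrite /X; case: ifP.
have XE t B : X t q = B -> (forall q', q' != q -> X t q' = X s q') ->
    [set x | forall q, X t q (edge (e q) x)] = Z `&` edge (e q) @^-1` B.
  move=> <- tE; apply/seteqP; split=> x /=.
    by move=> Xx; split=> [q' q'q|//]; rewrite -tE.
  by move=> [Zx Bx] q'; case: (eqVneq q' q) => [->//|q'q]; rewrite tE//; exact: Zx.
rewrite (XE _ (H q)); last 2 first.
- by rewrite /X inE eqxx.
- by move=> q' /negbTE q'q; rewrite /X inE q'q.
apply: (hull_step (mA q) (AH q) mZ CZ).
by rewrite -(XE s) // /X (negbTE qs).
Qed.

End Counting.

(** * Algebras of fibers *)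

Section NullEquality.
Context d (T : measurableType d) (R : realType) (mu : {measure set T -> \bar R}).

Definition aeq (A B : set T) := mu.-negligible ((A `\` B) `|` (B `\` A)).

Lemma aeq_refl A : aeq A A.
Proof. by rewrite /aeq setDv setU0; exact: negligible_set0. Qed.

Lemma aeq_trans B A D : aeq A B -> aeq B D -> aeq A D.
Proof.
move=> AB BD; apply: negligibleS (negligibleU AB BD) => x /=.
by have [Bx|nBx] := pselect (B x); move=> [[]|[]]; tauto.
Qed.

Lemma aeq_bigcup (A B : (set T)^nat) : (forall k, aeq (A k) (B k)) ->
  aeq (\bigcup_k A k) (\bigcup_k B k).
Proof.
move=> AB; apply: negligibleS (negligible_bigcup AB) => x.
case=> -[[k _ kx] nx]; exists k => //; [left|right]; split=> // kx'; apply: nx.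
  by exists k.
by exists k.
Qed.

(** This allows membership in [C] up to null sets to be checked on generators. *)
Lemma aeq_salg (C : set (set T)) : sigma_algebra setT C ->
  sigma_algebra setT [set A | exists2 B, C B & aeq A B].
Proof.
move=> sC; split.
- by exists set0; [case: sC|exact: aeq_refl].
- move=> A [B CB AB]; rewrite setTD; exists (~` B); first exact: salgC.
  apply: negligibleS AB => x /=.
  by move=> [[nA /contrapT Bx]|[nB nnA]]; [right|left; split=> //; apply: contrapT].
- move=> A CA.
  exists (\bigcup_k projT1 (cid2 (CA k))).
    case: sC => _ _; apply => k; by case: (cid2 (CA k)).
  by apply: aeq_bigcup => k; case: (cid2 (CA k)).
Qed.

End NullEquality.

Lemma salg_preimage T T' (g : T -> T') (C : set (set T)) : sigma_algebra setT C ->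
  sigma_algebra setT [set D | C (g @^-1` D)].
Proof.
move=> sC; split=> /=.
- by rewrite preimage_set0; case: sC.
- by move=> A CA; rewrite setTD preimage_setC; exact: salgC.
- by move=> A CA; rewrite preimage_bigcup; case: sC => _ _; exact.
Qed.

Section FiberAlgebra.
Context (R : realType) (m : nat) (V : 'I_m -> pointedType).
Variable P : graded_probability R V.
Context (f : (forall i, V i) -> R).
Context (f_meas : gen_measurable (gB P (@onesm m)) (f \o @btuple m V)).
Local Notation T1 := (bpow V (@onesm m)).
Local Notation mu := (gmu P (@onesm m)).

(** Fibers are handled as subsets of the full product, with the coordinates off [J] frozen; this
    avoids a separate type for each [J]. *)
Definition bmix n (J : {set 'I_m}) (v w : bpow V n) : bpow V n :=
  fun i j => if i \in J then v i j else w i j.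

Lemma bmixA n J J' (v w w' : bpow V n) :
  bmix J' (bmix J v w) w' = bmix (J :&: J')%SET v (bmix J' w w').
Proof.
apply: functional_extensionality_dep => i; apply/funext => j.
by rewrite /bmix inE; case: (i \in J'); rewrite ?andbT ?andbF//.
Qed.

Definition fib J (u : T1) (q : R) : set T1 :=
  [set v | f (btuple (bmix J v u)) < q].

Lemma fib_setT u q : fib [set: 'I_m]%SET u q = [set v | f (btuple v) < q].
Proof.
rewrite /fib; apply/funext => v /=; congr (is_true (f _ < q)).
by apply: functional_extensionality_dep => i; rewrite /btuple /bmix inE.
Qed.

Definition fib_gen (t : nat) : set (set T1) :=
  [set D | exists (J : {set 'I_m}) (u : T1) (q : R),
    [/\ (#|J| <= t)%N, dyadic01 q & D = fib J u q]].

(** The algebra [C_t] of the overview, pulled back to the full product. *)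
Definition fib_salg (t : nat) := <<s fib_gen t >>.

Lemma fib_salgP t : sigma_algebra setT (fib_salg t).
Proof. exact: smallest_sigma_algebra. Qed.

Lemma fib_in_salg t (J : {set 'I_m}) u q : (#|J| <= t)%N -> dyadic01 q -> fib_salg t (fib J u q).
Proof. by move=> Jt dq; apply: sub_sigma_algebra; exists J, u, q. Qed.

(** Freezing the coordinates off [J] in a fiber over [J'] leaves a fiber over their intersection.
    Only the size of this intersection counts, so [J'] itself may have more than [t] elements. *)
Lemma fib_section t (J J' : {set 'I_m}) (u u' : T1) q : (#|J :&: J'| <= t)%N -> dyadic01 q ->
  fib_salg t [set v | fib J' u' q (bmix J v u)].
Proof.
move=> Jt dq; have := fib_in_salg (bmix J' u u') Jt dq; congr fib_salg.
by apply/funext => v; rewrite /fib /= bmixA.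
Qed.

Lemma fib_salg_section t (D : set T1) (J : {set 'I_m}) (u : T1) :
  fib_salg t D -> fib_salg t [set v | D (bmix J v u)].
Proof.
move: D; apply: smallest_sub.
  exact: (salg_preimage (fun v => bmix J v u) (fib_salgP t)).
move=> _ [J' [u' [q [J't dq ->]]]]; apply: fib_section => //.
by apply: leq_trans J't; exact/subset_leq_card/subsetIr.
Qed.

Section Cylinder.
Context (J : {set 'I_m}) (u : T1) (q : R).

(** The sets [I] and [X] present [fib J u q] as a cylinder: block [i] keeps its only coordinate when
    [i] is in [J], and none otherwise. *)
Let I (i : 'I_m) : {set 'I_(@onesm m i)} := if i \in J then [set: _]%SET else finset.set0.
Let a i (j : 'I_#|I i|) : 'I_(@onesm m i) := enum_val j.

Let X : set (bpow V (fun i => #|I i|)) := [set y | f (btuple (upd a y u)) < q].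

Lemma fib_base : gB P _ X.
Proof.
apply: (@upd_fiber _ _ _ P _ _ a [set v | f (btuple v) < q]).
rewrite -gB_measurable.
have := f_meas measurableT (measurable_itv `]-oo, q[); rewrite setTI.
by congr measurable; apply/funext => x; rewrite /= in_itv.
Qed.

Lemma fib_bsub : fib J u q = [set x | X (bsub I x)].
Proof.
apply/funext => x; rewrite /fib /X /=; congr (is_true (f _ < q)).
apply: functional_extensionality_dep => i; rewrite /btuple /upd /bmix /bsub /a.
case: pickP => [l /eqP <-|nl].
  by have := enum_valP l; rewrite {2}/I; case: ifP => //; rewrite inE.
case: ifP => // iJ; have iI : ord0 \in I i by rewrite /I iJ inE.
by have := nl (enum_rank_in iI ord0); rewrite enum_rankK_in// eqxx.
Qed.

Lemma fib_meas : gB P _ (fib J u q).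
Proof.
rewrite fib_bsub.
by have [] := bsel_preimage (P := P) (s := a) (fun i => @enum_val_inj _ (I i)) fib_base.
Qed.

Lemma fib_cylinder t : (#|J| <= t)%N -> cylinders P (@onesm m) t (fib J u q).
Proof.
move=> Jt; exists I, X; split; [|exact: fib_base|exact: fib_bsub].
apply: leq_trans Jt; rewrite -sum1_card [leqRHS]big_mkcond /=.
apply: leq_sum => i _; rewrite /I; case: ifP => _; first by rewrite cardsT card_ord.
by rewrite cards0.
Qed.

End Cylinder.

Lemma fib_salg_meas t : fib_salg t `<=` gB P (@onesm m).
Proof.
apply: smallest_sub; first exact: gB_sigma.
by move=> _ [J [u [q [_ _ ->]]]]; exact: fib_meas.
Qed.

(** A chosen hull; the value [set0] is a default that [fhullP] excludes for measurable sets. *)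
Definition fhull t (A : set T1) : set T1 :=
  if pselect (exists H, is_hull mu (fib_salg t) A H) is left e then projT1 (cid e)
  else set0.

Lemma fhullP t A : gB P _ A -> is_hull mu (fib_salg t) A (fhull t A).
Proof.
move=> mA; rewrite /fhull; case: pselect => [e|[]]; first exact: projT2.
apply: hull_exists; first exact: fib_salgP.
  by move=> D /fib_salg_meas; rewrite gB_measurable.
by rewrite gB_measurable.
Qed.

End FiberAlgebra.

(** * Shattering *)

Section Shattering.
Context (R : realType) (k m : nat) (V : 'I_m -> pointedType).
Context (f : (forall i, V i) -> R) (d : R -> R -> nat).
Context (J K : {set 'I_m}) (cK : (#|~: K| + k.+1 = m)%N).
Context (D N : nat) (DN : (D <= N.+1)%N).
Context (QN : (#|{set {ffun 'I_k -> 'I_D}}| <= N.+1)%N).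

Let fc := free_coord cK.

(** A grid point paired with a subset of the grid. [DN] and [QN] ensure that [N.+1] vertices per
    part suffice to label both the grid values and the subsets. *)
Definition pattern : finType := ({ffun 'I_k -> 'I_D} * {set {ffun 'I_k -> 'I_D}})%type.

(* The edge of the blow-up attached to the grid point [q.1] and the subset [q.2] of
   the grid: [q.2] labels the vertex in the last free coordinate. *)
Definition pattern_edge (q : pattern) (i : 'I_m) : 'I_N.+1 :=
  if [pick l | fc l == i] is Some l then
    if unlift ord_max l is Some l0 then inord (q.1 l0) else inord (enum_rank q.2)
  else ord0.

Lemma free_coord_inj : injective fc.
Proof. by move=> l l' /enum_val_inj /cast_ord_inj. Qed.

Lemma pattern_edge_free q l : pattern_edge q (fc l) =
  if unlift ord_max l is Some l0 then inord (q.1 l0) else inord (enum_rank q.2).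
Proof.
rewrite /pattern_edge; case: pickP => [l' /eqP/free_coord_inj ->//|/(_ l)].
by rewrite eqxx.
Qed.

Lemma pattern_edge_lift q l : pattern_edge q (fc (lift ord_max l)) = inord (q.1 l).
Proof. by rewrite pattern_edge_free liftK. Qed.

Lemma pattern_edge_max q : pattern_edge q (fc ord_max) = inord (enum_rank q.2).
Proof. by rewrite pattern_edge_free unlift_none. Qed.

Lemma pattern_edge_out q i : i \notin K -> pattern_edge q i = ord0.
Proof.
move=> iK; rewrite /pattern_edge; case: pickP => // l /eqP fl.
by have := free_coord_notin cK l; rewrite -/fc fl inE iK.
Qed.

Lemma fc_in l : fc l \in K.
Proof. by have := free_coord_notin cK l; rewrite -/fc inE negbK. Qed.

Lemma fcP i : i \in K -> exists l, i = fc l.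
Proof.
move=> iK; have iK' : i \in ~: ~: K by rewrite finset.setCK.
by exists (free_rank cK iK'); rewrite /fc free_rankK.
Qed.

(** Distinct labels have distinct images under [inord], as they stay below [N.+1]. The difference
    lies inside [K], which is what bounds the overlap of two edges. *)
Lemma pattern_edge_neq q q' : q' != q ->
  exists2 i, i \in K & pattern_edge q i != pattern_edge q' i.
Proof.
move=> q'q; apply: contrapT => H; move/eqP: q'q; apply.
have E i : i \in K -> pattern_edge q i = pattern_edge q' i.
  by move=> iK; apply: contrapT => /eqP ne; apply: H; exists i.
case: q q' E {H} => [h S] [h' S'] E; congr (_, _).
  apply/ffunP => l; apply/val_inj.
  have := E _ (fc_in (lift ord_max l)); rewrite !pattern_edge_lift /=.
  move=> /(congr1 (@nat_of_ord _)); rewrite !inordK//; exact: leq_trans (ltn_ord _) DN.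
apply/enum_rank_inj/val_inj.
have := E _ (fc_in ord_max); rewrite !pattern_edge_max /= => /(congr1 (@nat_of_ord _)).
by rewrite !inordK//; exact: leq_trans (ltn_ord _) QN.
Qed.

(** The first [k] free coordinates of [K] carry a box of side [D], and the vertex labelled by a
    subset of the grid cuts out exactly that subset: the box would be shattered. *)
Lemma no_pattern (KJ : K \subset J) (r s : R) (x : bpow V (fun=> N.+1))
    (u : bpow V (@onesm m)) :
  VC_le k f d -> d r s = D -> 0 <= r -> r < s -> s <= 1 ->
  ~ (forall q : pattern,
      let y := f (btuple (bmix J (edge (n := fun=> N.+1) (pattern_edge q) x) u)) in
      if q.1 \in q.2 then y < r else s <= y).
Proof.
move=> fVC dD r0 rs s1 H.
(* Off [K] every pattern edge uses vertex 0, so these coordinates are common to all edges and define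
   one fiber of [f]. *)
pose b i (_ : i \in ~: K) : V i := if i \in J then x i ord0 else u i ord0.
pose pt (l : 'I_k) (j : nat) := x (fc (lift ord_max l)) (inord j).
pose A l := pt l @` `I_D.
apply: (fVC (~: K) cK b r s r0 rs s1 A).
  move=> l; rewrite dD; apply: inj_card_eq => j j'; rewrite !inE /= => jD j'D e.
  apply: contrapT => /eqP jj'.
  (* The side [A l] has [D] distinct points: if the labels [j] and [j'] gave the same vertex, then
     [h] and [h'] would give the same edge for [S], with a value both below [r] and at least [s]. *)
  pose S := [set h : {ffun 'I_k -> 'I_D} | h l == Ordinal jD]%SET.
  pose h : {ffun 'I_k -> 'I_D} := [ffun=> Ordinal jD].
  pose h' : {ffun 'I_k -> 'I_D} :=
    [ffun l' => if l' == l then Ordinal j'D else Ordinal jD].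
  have := H (h, S); have := H (h', S) => /=.
  rewrite !inE !ffunE eqxx eqxx -val_eqE /= eq_sym (negbTE jj').
  suff -> : edge (n := fun=> N.+1) (pattern_edge (h', S)) x =
            edge (n := fun=> N.+1) (pattern_edge (h, S)) x.
    by move=> /le_lt_trans/[apply]; rewrite ltNge (ltW rs).
  apply: functional_extensionality_dep => i; apply/funext => j0; rewrite /edge.
  have [iK|iK] := boolP (i \in K); last by rewrite !pattern_edge_out.
  have [l1 ->] := fcP iK.
  case: (unliftP ord_max l1) => [l2|] ->; last by rewrite !pattern_edge_max.
  rewrite !pattern_edge_lift /= !ffunE; case: eqP => // ->.
  by rewrite -[LHS]e.
move=> S Sbox.
pose S' := [set h : {ffun 'I_k -> 'I_D} | `[< S (fun l => pt l (h l)) >]]%SET.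
(* The vertex labelled by the subset [S'] of the grid that corresponds to [S]. *)
exists (x (fc ord_max) (inord (enum_rank S'))) => y ymax a.
suff E (h : {ffun 'I_k -> 'I_D}) : a = (fun l => pt l (h l)) ->
    fiber_fun f b y = f (btuple (bmix J (edge (n := fun=> N.+1) (pattern_edge (h, S')) x) u)).
  have box_h : [set a : forall l, V (fc (lift ord_max l)) | forall l, A l (a l)] a ->
      exists h : {ffun 'I_k -> 'I_D}, a = (fun l => pt l (h l)).
    move=> /= Aa; pose j l := projT1 (cid2 (Aa l)).
    have jD l : (j l < D)%N by rewrite /j; case: cid2.
    exists [ffun l => Ordinal (jD l)].
    apply: functional_extensionality_dep => l; rewrite ffunE /= /j.
    by case: cid2.
  split.
    move=> Sa; have [h ah] := box_h (Sbox _ Sa); rewrite (E h ah).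
    have := H (h, S') => /=; rewrite inE -ah.
    by case: asboolP => // _ /ltW.
  move=> [/box_h [h ah] nSa]; rewrite (E h ah).
  have := H (h, S') => /=; rewrite inE -ah.
  by case: asboolP.
move=> ah; rewrite /fiber_fun; congr (f _).
apply: functional_extensionality_dep => i; rewrite /btuple /bmix /edge.
have [iK|iK] := boolP (i \in K); last first.
  have iK' : i \in ~: K by rewrite inE.
  by rewrite (merge_in _ _ iK') /b pattern_edge_out.
rewrite (fintype.subsetP KJ _ iK); have [l {iK} ->] := fcP iK.
rewrite merge_free; case: (unliftP ord_max l) => [l0|] ->.
  by rewrite pattern_edge_lift /=; have := congr1 (fun g => g l0) ah.
by rewrite pattern_edge_max.
Qed.

End Shattering.

(** Two edges interact only through their common vertices. *)
Lemma edge_upd_bmix m (V : 'I_m -> pointedType) n (e e' : forall i, 'I_(n i))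
    (v : bpow V (@onesm m)) (w : bpow V n) :
  edge e' (upd (fun i (_ : 'I_(@onesm m i)) => e i) v w) =
  bmix [set i | e i == e' i]%SET v (edge e' w).
Proof.
apply: functional_extensionality_dep => i; apply/funext => j.
rewrite /edge /upd /bmix inE; case: pickP => [l ->|/(_ j) ->//].
by rewrite (ord1 l) (ord1 j).
Qed.

(** * Descent to fibers in at most k coordinates *)

Section Reduction.
Context (R : realType) (k m : nat) (V : 'I_m -> pointedType).
Variable P : graded_probability R V.
Context (f : (forall i, V i) -> R) (d : R -> R -> nat).
Context (f_meas : gen_measurable (gB P (@onesm m)) (f \o @btuple m V)).
Context (f01 : forall x, 0 <= f x <= 1) (f_VC : VC_le k f d).
Local Notation T1 := (bpow V (@onesm m)).
Local Notation mu := (gmu P (@onesm m)).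

Lemma dyadic01_itv (q : R) : dyadic01 q -> 0 <= q <= 1.
Proof.
move=> [a [b [ab ->]]]; rewrite divr_ge0 ?exprn_ge0//= ler_pdivrMr ?exprn_gt0//.
by rewrite mul1r -natrX ler_nat.
Qed.

(** Were the intersection nonnull, its blow-up would contain a nonnull set of patterns for the
    hulls, hence by [counting] a pattern for the original sets, against [no_pattern]. *)
Lemma hull_disjoint t (J : {set 'I_m}) (u : T1) (r s : R) :
  (#|J| <= t.+1)%N -> (k < #|J|)%N -> dyadic01 r -> dyadic01 s -> r < s ->
  mu (fhull P f t (fib f J u r) `&` fhull P f t (~` fib f J u s)) = 0%E.
Proof.
move=> Jt kJ dr ds rs.
have m0 q : gB P _ (fib f J u q) by exact: fib_meas.
have m1 q : gB P _ (~` fib f J u q) by apply: gB_C; exact: fib_meas.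
pose H0 := fhull P f t (fib f J u r); pose H1 := fhull P f t (~` fib f J u s).
have hull0 : is_hull mu (fib_salg f t) (fib f J u r) H0 by exact: fhullP.
have hull1 : is_hull mu (fib_salg f t) (~` fib f J u s) H1 by exact: fhullP.
apply: contrapT => muW.
have mW : gB P _ (H0 `&` H1).
  by apply: gB_I; apply: (fib_salg_meas f_meas (t := t)); [case: hull0|case: hull1].
have [K KJ cK] : exists2 K : {set 'I_m}, K \subset J & #|K| = k.+1.
  have [s' [us ss sJ]] := card_geqP kJ.
  exists [set i in s']%SET; last by rewrite cardsE (card_uniqP us).
  by apply/fintype.subsetP => i; rewrite inE; exact: sJ.
have cK' : (#|~: K| + k.+1 = m)%N by rewrite -cK addnC cardsC card_ord.
pose D := d r s.
pose N := maxn D #|{set {ffun 'I_k -> 'I_D}}|.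
have DN : (D <= N.+1)%N by rewrite (leq_trans (leq_maxl _ _) (leqnSn _)).
have QN : (#|{set {ffun 'I_k -> 'I_D}}| <= N.+1)%N.
  by rewrite (leq_trans (leq_maxr _ _) (leqnSn _)).
pose e := @pattern_edge k m K cK' D N.
pose A (q : pattern k D) := if q.1 \in q.2 then fib f J u r else ~` fib f J u s.
pose H (q : pattern k D) := if q.1 \in q.2 then H0 else H1.
have [Z [mZ muZ ZW]] := @blowup _ _ _ P _ mW muW (fun=> N.+1) (fun=> isT).
have mA q : gB P (@onesm m) (A q) by rewrite /A; case: ifP.
have AH q : is_hull mu (fib_salg f t) (A q) (H q) by rewrite /A /H; case: ifP.
have Ce q q' : q' != q -> forall w,
    fib_salg f t [set v | A q' (edge (n := fun=> N.+1) (e q')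
       (upd (fun i (_ : 'I_(@onesm m i)) => e q i) v w))] /\
    fib_salg f t [set v | H q' (edge (n := fun=> N.+1) (e q')
       (upd (fun i (_ : 'I_(@onesm m i)) => e q i) v w))].
  move=> q'q w; have [i iK ei] := pattern_edge_neq cK' DN QN q'q.
  (* The coordinates shared by the two edges. They miss some [i] in [K], hence in [J], so at most
     [t] of them lie in [J]. *)
  pose J' := [set i | e q i == e q' i]%SET.
  have JJ' : (#|J' :&: J| <= t)%N.
    rewrite -ltnS; apply: leq_trans Jt; apply: proper_card.
    rewrite properE subsetIr /=; apply/fintype.subsetPn; exists i.
      exact: (fintype.subsetP KJ).
    by rewrite !inE (negbTE ei).
  have mixE B : [set v | B (edge (n := fun=> N.+1) (e q')
       (upd (fun i (_ : 'I_(@onesm m i)) => e q i) v w))] =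
     [set v | B (bmix J' v (edge (n := fun=> N.+1) (e q') w))].
    by apply/funext => v /=; rewrite edge_upd_bmix.
  rewrite !mixE; split; last first.
    by apply: fib_salg_section; rewrite /H; case: ifP => _; [case: hull0|case: hull1].
  rewrite /A; case: ifP => _; first exact: fib_section.
  have := salgC (fib_salgP f t) (fib_section (edge (n := fun=> N.+1) (e q') w) u JJ' ds).
  by [].
have mHQ : gB P (fun=> N.+1)
    [set x | forall q, H q (edge (n := fun=> N.+1) (e q) x)].
  have := salg_forall (@gB_sigma _ _ _ P (fun=> N.+1)) (p := @predT (pattern k D))
    (F := fun q => edge (n := fun=> N.+1) (e q) @^-1` H q).
  rewrite (_ : [set x | _] = [set x | forall q, H q (edge (n := fun=> N.+1) (e q) x)]).
    by apply=> q _; apply: edge_meas; rewrite /H; case: ifP => _;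
      apply: (fib_salg_meas f_meas (t := t)); [case: hull0|case: hull1].
  by apply/funext => x /=; rewrite propeqE; split=> Hx q; [exact: Hx|move=> _].
have [x Ax] : exists x, forall q, A q (edge (n := fun=> N.+1) (e q) x).
  apply: contrapT => noA; apply: muZ.
  apply: gmu_sub0 mZ mHQ _ _.
    by move=> x /ZW Wx q; rewrite /H; case: ifP => _; case: (Wx (e q)).
  apply: (counting (fib_salgP f t) (fib_salg_meas f_meas (t := t)) mA AH Ce).
  rewrite (_ : [set x | _] = set0) ?measure0//.
  by apply/seteqP; split=> x // Ax; apply: noA; exists x.
exfalso.
have [/andP[r0 _] /andP[_ s1]] := (dyadic01_itv dr, dyadic01_itv ds).
apply: (@no_pattern R k m V f d J K cK' D N KJ r s x u f_VC erefl r0 rs s1).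
move=> q /=; have := Ax q; rewrite /A /fib; case: ifP => _ //= /negP.
by rewrite -leNgt.
Qed.

(** Dyadic levels [r n] increase to [q], and the union of the hulls of the sets below [r n] is the
    required set. *)
Lemma fib_lower t (J : {set 'I_m}) (u : T1) (q : R) :
  (#|J| <= t.+1)%N -> (k < #|J|)%N -> dyadic01 q ->
  exists2 B, fib_salg f t B & aeq mu (fib f J u q) B.
Proof.
move=> Jt kJ [a [b [ab qE]]].
have dq : dyadic01 q by exists a, b.
have [a0|a_gt0] := posnP a.
  exists set0; first by case: (fib_salgP f t).
  rewrite (_ : fib f J u q = set0); first exact: aeq_refl.
  apply/seteqP; split=> v //; rewrite /fib /= qE a0 mul0r ltNge.
  by case/andP: (f01 (btuple (bmix J v u))) => ->.
(* This is [q] minus [2 ^- (b + n)], still in [0,1] since [a] is positive. *)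
pose r n : R := (a * 2 ^ n).-1%:R / 2 ^+ (b + n).
have an_gt0 n : (0 < a * 2 ^ n)%N by rewrite muln_gt0 a_gt0 expn_gt0.
have qn n : q = (a * 2 ^ n)%:R / 2 ^+ (b + n).
  by rewrite qE natrM natrX exprD -mulf_div divff ?mulr1// expf_neq0.
have dr n : dyadic01 (r n).
  exists (a * 2 ^ n).-1, (b + n)%N; split=> //.
  by rewrite expnD (leq_trans (leq_pred _))// leq_mul2r ab orbT.
have rq n : r n < q.
  by rewrite (qn n) /r ltr_pM2r ?invr_gt0 ?exprn_gt0// ltr_nat prednK.
pose H n := fhull P f t (fib f J u (r n)).
pose H1 := fhull P f t (~` fib f J u q).
have m0 q' : gB P _ (fib f J u q') by exact: fib_meas.
have m1 q' : gB P _ (~` fib f J u q') by apply: gB_C; exact: fib_meas.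
have hull0 n : is_hull mu (fib_salg f t) (fib f J u (r n)) (H n) by exact: fhullP.
have hull1 : is_hull mu (fib_salg f t) (~` fib f J u q) H1 by exact: fhullP.
have mH n : gB P _ (H n) by apply: (fib_salg_meas f_meas (t := t)); case: (hull0 n).
have mH1 : gB P _ H1 by apply: (fib_salg_meas f_meas (t := t)); case: hull1.
have neg A : gB P _ A -> mu A = 0%E -> mu.-negligible A.
  by move=> mA A0; apply/negligibleP; rewrite ?gB_measurable.
exists (\bigcup_n H n).
  by case: (fib_salgP f t) => _ _; apply => n; case: (hull0 n).
(* A point below [q] is below some [r n], hence in [H n] up to a null set. A point of [H n] not
   below [q] lies in [H1] up to a null set, and [H n] meets [H1] in a null set. *)
apply: (@negligibleS _ _ _ mu (((\bigcup_n (fib f J u (r n) `\` H n)) `|`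
    (\bigcup_n (H n `&` H1))) `|` ((~` fib f J u q) `\` H1))).
  move=> v [[fv nHv]|[[n _ Hnv] nfv]].
    left; left.
    suff [n fn] : exists n, fib f J u (r n) v.
      by exists n => //; split=> // Hnv; apply: nHv; exists n.
    pose y := f (btuple (bmix J v u)); have yq : y < q by [].
    have [n ne] : exists n : nat, n.+1%:R^-1 < q - y.
      have qy : 0 < q - y by rewrite subr_gt0.
      by have [n _ /(_ n (leqnn _))/=] := near_infty_natSinv_lt (PosNum qy); exists n.
    exists n; rewrite /fib /= -/y.
    have -> : r n = q - (2 ^+ (b + n))^-1.
      by rewrite (qn n) /r -subn1 natrB// mulrBl mul1r.
    rewrite ltrBrDr addrC -ltrBrDr; apply: le_lt_trans ne.
    rewrite lef_pV2 ?posrE ?exprn_gt0// -natrX ler_nat.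
    by rewrite (leq_trans (ltn_expl n (ltnSn 1)))// leq_exp2l// leq_addl.
  have [H1v|nH1v] := pselect (H1 v); last by right.
  by left; right; exists n.
apply: negligibleU; first apply: negligibleU.
- apply: negligible_bigcup => n; apply: neg; last by case: (hull0 n).
  by rewrite setDE; apply: gB_I => //; exact: gB_C.
- apply: negligible_bigcup => n; apply: neg; first exact: gB_I.
  exact: hull_disjoint.
- apply: neg; last by case: hull1.
  by rewrite setDE; apply: gB_I => //; exact: gB_C.
Qed.

(** Checked on generators: a fiber in more than [k] coordinates loses one coordinate by [fib_lower],
    and induction does the rest. *)
Lemma fib_salg_lower t D : fib_salg f (k + t) D ->
  exists2 B, fib_salg f k B & aeq mu D B.
Proof.
elim: t D => [|t IH] D; first by rewrite addn0 => kD; exists D => //; exact: aeq_refl.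
rewrite addnS; move: D; apply: smallest_sub.
  exact: (aeq_salg mu (fib_salgP f k)).
move=> _ [J [u [q [Jt dq ->]]]].
have [Jk|kJ] := leqP #|J| k.
  by exists (fib f J u q); [exact: fib_in_salg|exact: aeq_refl].
have [B /IH[B' kB' BB'] JB] := fib_lower u Jt kJ dq.
by exists B' => //; exact: aeq_trans JB BB'.
Qed.

Lemma sublevel_lower q : dyadic01 q ->
  exists2 B, fib_salg f k B & aeq mu [set v | f (btuple v) < q] B.
Proof.
move=> dq; apply: (@fib_salg_lower m).
have := @fib_in_salg _ _ _ f (k + m) [set: 'I_m]%SET point q _ dq.
by rewrite fib_setT; apply; rewrite cardsT card_ord leq_addl.
Qed.

End Reduction.

(** * Approximation by sums of products *)

Section ProductSums.
Context (R : realType) (k m : nat) (V : 'I_m -> pointedType).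
Variable P : graded_probability R V.
Context (f : (forall i, V i) -> R).
Context (f_meas : gen_measurable (gB P (@onesm m)) (f \o @btuple m V)).
Local Notation T1 := (bpow V (@onesm m)).
Local Notation mu := (gmu P (@onesm m)).

Definition family := forall I : {set 'I_m}, bpow V (indm I) -> R.

Definition fiber_family (F : family) := forall I : {set 'I_m}, (#|I| <= k)%N ->
  gen_measurable (fiber_sets f I) (F I) /\ forall x, 0 <= F I x <= 1.

Definition family_prod (F : family) (x : forall i, V i) : R :=
  \prod_(I : {set 'I_m} | (#|I| <= k)%N) F I (brestr I x).

(** No coefficients, so that sums and products stay in the class; the weights enter only at the
    end. *)
Definition sum_of_products (phi : T1 -> R) := exists (Q : finType) (F : Q -> family),
  (forall q, fiber_family (F q)) /\
  forall x, phi x = \sum_q family_prod (F q) (btuple x).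

Lemma sum_of_products0 : sum_of_products (fun=> 0).
Proof.
exists 'I_0, (fun _ _ _ => 0); split=> [[]//|x].
by rewrite big_ord0.
Qed.

Lemma sum_of_products1 : sum_of_products (fun=> 1).
Proof.
exists unit, (fun _ _ _ => 1); split=> [_ I _|x].
  by split=> [|y]; [exact: measurable_cst|rewrite ler01 lexx].
by rewrite big_const card_unit /= addr0 /family_prod big1.
Qed.

Lemma sum_of_productsD phi psi : sum_of_products phi -> sum_of_products psi ->
  sum_of_products (fun x => phi x + psi x).
Proof.
move=> [Q [F [Fm FE]]] [Q' [F' [Fm' FE']]].
exists (Q + Q')%type, (fun q => match q with inl a => F a | inr b => F' b end).
by split=> [[]//|x]; rewrite big_sumType /= FE FE'.
Qed.

Lemma sum_of_productsM phi psi : sum_of_products phi -> sum_of_products psi ->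
  sum_of_products (fun x => phi x * psi x).
Proof.
move=> [Q [F [Fm FE]]] [Q' [F' [Fm' FE']]].
exists (Q * Q')%type, (fun q I y => F q.1 I y * F' q.2 I y); split=> [q I Ik|x].
  have [mF F01] := Fm q.1 I Ik; have [mF' F01'] := Fm' q.2 I Ik.
  split; first exact: measurable_funM.
  move=> y; have /andP[a0 a1] := F01 y; have /andP[b0 b1] := F01' y.
  by rewrite mulr_ge0//= mulr_ile1.
rewrite FE FE' big_distrlr /= pair_bigA /=; apply: eq_bigr => q _.
by rewrite /family_prod big_split.
Qed.

Lemma sum_of_products_sum (I : finType) (phi : I -> T1 -> R) :
  (forall i, sum_of_products (phi i)) ->
  sum_of_products (fun x => \sum_i phi i x).
Proof.
move=> H; suff S (s : seq I) : sum_of_products (fun x => \sum_(i <- s) phi i x).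
  exact: S.
elim: s => [|i s IH].
  rewrite (_ : (fun _ => _) = fun=> 0); first exact: sum_of_products0.
  by apply/funext => x; rewrite big_nil.
rewrite (_ : (fun _ => _) = fun x => phi i x + \sum_(j <- s) phi j x).
  exact: sum_of_productsD.
by apply/funext => x; rewrite big_cons.
Qed.

Lemma sum_of_products_slice (J : {set 'I_m}) (E : set (bpow V (indm J))) :
  (#|J| <= k)%N -> <<s fiber_sets f J >> E ->
  sum_of_products (fun x => \1_[set x : T1 | E (brestr J (btuple x))] x).
Proof.
move=> Jk mE.
(* The indicator of [E] sits at [J], transported along [J = I]; all other factors are 1. *)
pose F : family := fun I => if J =P I is ReflectT e
  then \1_(ecast I (set (bpow V (indm I))) e E) else fun=> 1.
exists unit, (fun=> F); split=> [_ I Ik|x].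
  rewrite /F; case: eqP => [e|_].
    destruct e => /=; split; first exact: measurable_indic.
    by move=> y; rewrite indicE ler0n lern1 leq_b1.
  by split=> [|y]; [exact: measurable_cst|rewrite ler01 lexx].
rewrite big_const card_unit /= addr0 /family_prod (bigD1 J)//= big1 ?mulr1.
  rewrite /F; case: eqP => // e; rewrite (eq_irrelevance e erefl) /= !indicE.
  by congr (_%:R); apply/idP/idP; rewrite !inE.
by move=> I /andP[_ IJ]; rewrite /F; case: eqP => // e; rewrite e eqxx in IJ.
Qed.

(* The algebra generated by the fiber sets in at most [k] coordinates; closure under
   complement is built in, so no normal form by disjoint boxes is needed. *)
Definition elementary (A : set T1) :=
  [/\ fib_salg f k A, sum_of_products (\1_A : T1 -> R) &
      sum_of_products (\1_(~` A) : T1 -> R)].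

Lemma indicI_fun (A B : set T1) : (\1_(A `&` B) : T1 -> R) = fun x => \1_A x * \1_B x.
Proof. by apply/funext => x; rewrite !indicE in_setI -natrM mulnb. Qed.

Lemma elementary0 : elementary set0.
Proof.
split; first by case: (fib_salgP f k).
  by rewrite indic0; exact: sum_of_products0.
by rewrite setC0 indicT; exact: sum_of_products1.
Qed.

Lemma elementaryC A : elementary A -> elementary (~` A).
Proof.
by move=> [fA A0 A1]; split; rewrite ?setCK//; exact: (salgC (fib_salgP f k)).
Qed.

Lemma elementaryI A B : elementary A -> elementary B -> elementary (A `&` B).
Proof.
move=> [fA A0 A1] [fB B0 B1]; split.
- exact: (salgI (fib_salgP f k)).
- by rewrite indicI_fun; exact: sum_of_productsM.
- rewrite (_ : \1__ = fun x => \1_(~` A) x + \1_A x * \1_(~` B) x :> R).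
    by apply: sum_of_productsD => //; exact: sum_of_productsM.
  apply/funext => x; rewrite !indicE !in_setC in_setI.
  by case: (x \in A); case: (x \in B); rewrite /= ?mul0r ?mul1r ?addr0 ?add0r.
Qed.

Lemma elementaryU A B : elementary A -> elementary B -> elementary (A `|` B).
Proof.
move=> eA eB; rewrite -[A `|` B]setCK setCU.
by apply: elementaryC; apply: elementaryI; exact: elementaryC.
Qed.

Lemma elementary_fib (J : {set 'I_m}) (u : T1) q : (#|J| <= k)%N -> dyadic01 q ->
  elementary (fib f J u q).
Proof.
move=> Jk dq.
pose E : set (bpow V (indm J)) := [set y | f (bglue y (btuple u)) < q].
have mE : <<s fiber_sets f J >> E.
  by apply: sub_sigma_algebra; exists (btuple u), q.
have EE : fib f J u q = [set x : T1 | E (brestr J (btuple x))].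
  apply/funext => x; rewrite /fib /E /=; congr (is_true (f _ < q)).
  apply: functional_extensionality_dep => i; rewrite {1}/btuple /bmix.
  have [iJ|iJ] := boolP (i \in J); last by rewrite bglue_out.
  have j : 'I_(indm J i) by rewrite /indm iJ; exact: ord0.
  by rewrite (bglue_in _ _ j).
split; first exact: fib_in_salg.
  by rewrite EE; exact: sum_of_products_slice.
rewrite EE; have := @sum_of_products_slice J (~` E) Jk.
by apply; rewrite -setTD; case: (@smallest_sigma_algebra _ setT (fiber_sets f J)) => _ + _; apply.
Qed.

Lemma elementary_meas A : elementary A -> gB P _ A.
Proof. by move=> [/(fib_salg_meas f_meas) + _ _]; exact. Qed.

Let symd (A B : set T1) := (A `\` B) `|` (B `\` A).

Let symd_meas A B : gB P _ A -> gB P _ B -> gB P _ (symd A B).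
Proof.
move=> mA mB; rewrite -gB_measurable.
by apply: measurableU; apply: measurableD; rewrite gB_measurable.
Qed.

Definition approximable (D : set T1) := gB P _ D /\ forall e : R, 0 < e ->
  exists2 A, elementary A & (mu (symd D A) < e%:E)%E.

Let mu_sub A B : gB P _ A -> gB P _ B -> A `<=` B -> (mu A <= mu B)%E.
Proof. by move=> mA mB AB; apply: le_measure => //; rewrite inE gB_measurable. Qed.

Let gB_U A B : gB P (@onesm m) A -> gB P (@onesm m) B -> gB P (@onesm m) (A `|` B).
Proof. by move=> mA mB; rewrite -gB_measurable; apply: measurableU; rewrite gB_measurable. Qed.

Let mu_subU A B D : gB P _ A -> gB P _ B -> gB P _ D -> A `<=` B `|` D ->
  (mu A <= mu B + mu D)%E.
Proof.
move=> mA mB mD AB; apply: (@le_trans _ _ (mu (B `|` D))).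
  by apply: mu_sub => //; exact: gB_U.
by apply: measureU2; rewrite gB_measurable.
Qed.

Lemma approximableU A B : approximable A -> approximable B -> approximable (A `|` B).
Proof.
move=> [mA hA] [mB hB]; split; first exact: gB_U.
move=> e e0; have e2 : 0 < e / 2 by rewrite divr_gt0.
have [A' eA' AA'] := hA _ e2; have [B' eB' BB'] := hB _ e2.
exists (A' `|` B'); first exact: elementaryU.
have mA' := elementary_meas eA'; have mB' := elementary_meas eB'.
apply: (@le_lt_trans _ _ (mu (symd A A') + mu (symd B B'))%E).
  apply: mu_subU; [|exact: symd_meas|exact: symd_meas|].
    by apply: symd_meas; exact: gB_U.
  by move=> x /=; rewrite /symd /=; tauto.
by rewrite [e]splitr EFinD lteD.
Qed.

(** A countable union is within [e / 2] of a finite partial union by continuity from above, and the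
    latter is within [e / 2] of an elementary set. *)
Lemma approximable_salg : sigma_algebra setT approximable.
Proof.
split.
- split; first by rewrite -gB_measurable; exact: measurable0.
  move=> e e0; exists set0; first exact: elementary0.
  by rewrite /symd setDv setU0 measure0 lte_fin.
- move=> A [mA hA]; rewrite setTD; split; first exact: gB_C.
  move=> e /hA[B eB AB]; exists (~` B); first exact: elementaryC.
  rewrite (_ : symd _ _ = symd A B)//; apply/seteqP; split=> x; rewrite /symd /=.
    by move=> [[nA /contrapT Bx]|[nB /contrapT Ax]]; [right|left].
  by tauto.
move=> F hF.
have mF n : gB P _ (F n) by case: (hF n).
have mU : gB P _ (\bigcup_n F n) by case: (@gB_sigma _ _ _ P (@onesm m)) => _ _; exact.
split=> // e e0; have e2 : 0 < e / 2 by rewrite divr_gt0.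
pose E n := \big[setU/set0]_(i < n) F i.
have hE n : approximable (E n).
  rewrite /E; elim: n => [|n IH]; last by rewrite big_ord_recr; exact: approximableU.
  rewrite big_ord0; split; first by rewrite -gB_measurable; exact: measurable0.
  move=> e' e'0; exists set0; first exact: elementary0.
  by rewrite /symd setDv setU0 measure0 lte_fin.
pose U := \bigcup_n F n.
have [n Un] : exists n, (mu (U `\` E n) < (e / 2)%:E)%E.
  have mE n : gB P _ (E n) by case: (hE n).
  have mUE n : gB P _ (U `\` E n) by rewrite setDE; apply: gB_I => //; exact: gB_C.
  have := @nonincreasing_cvg_mu _ _ _ mu (fun n => U `\` E n).
  have -> : \bigcap_n (U `\` E n) = set0.
    apply/seteqP; split=> x //= Hx; have [[n _ Fx] _] := Hx 0%N I.
    have [_] := Hx n.+1 I; apply; rewrite /E -bigcup_mkord.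
    by exists n => //=.
  rewrite measure0 => cvg_mu.
  have : mu \o (fun n => U `\` E n) @ \oo --> 0%E.
    apply: cvg_mu.
    - by rewrite ltey_eq fin_num_measure// gB_measurable.
    - by move=> n; rewrite gB_measurable.
    - exact: measurable0.
    - move=> i j ij; apply/subsetPset => x [Ux nE]; split=> // Ex; apply: nE.
      move: Ex; rewrite /E -!bigcup_mkord => -[l /= li Fl]; exists l => //=.
      exact: leq_trans li ij.
  move=> /fine_cvgP[_ /cvgrPdist_lt/(_ _ e2)[n _ /(_ n (leqnn n))]] /=.
  rewrite sub0r normrN => h; exists n.
  rewrite -[mu _]fineK ?fin_num_measure ?gB_measurable// lte_fin.
  exact: le_lt_trans (ler_norm _) h.
have [mE hEn] := hE n; have [A eA EA] := hEn _ e2; exists A => //.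
have mA := elementary_meas eA.
apply: (@le_lt_trans _ _ (mu (U `\` E n) + mu (symd (E n) A))%E).
  apply: mu_subU; [exact: symd_meas| |exact: symd_meas|].
    by rewrite setDE; apply: gB_I => //; exact: gB_C.
  have EU : E n `<=` U by rewrite /E -bigcup_mkord => x [l _ Fx]; exists l.
  move=> x; rewrite /symd /=; have := EU x.
  by have [En|nEn] := pselect (E n x); tauto.
by rewrite [e]splitr EFinD lteD.
Qed.

Lemma fib_salg_approximable D : fib_salg f k D -> approximable D.
Proof.
move: D; apply: smallest_sub; first exact: approximable_salg.
move=> _ [J [u [q [Jk dq ->]]]]; have eJ := elementary_fib u Jk dq; split.
  exact: elementary_meas.
move=> e e0; exists (fib f J u q) => //.
by rewrite /symd setDv setU0 measure0 lte_fin.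
Qed.

Lemma aeq_approximable D B : gB P _ D -> fib_salg f k B -> aeq mu D B ->
  forall e : R, 0 < e -> exists2 A, elementary A & (mu (symd D A) < e%:E)%E.
Proof.
move=> mD kB DB e e0; have [mB /(_ e e0)[A eA BA]] := fib_salg_approximable kB.
exists A => //; apply: le_lt_trans BA; rewrite -[leRHS]add0e.
have <- : mu (symd D B) = 0%E.
  by apply/negligibleP => //; rewrite gB_measurable; exact: symd_meas.
have mA := elementary_meas eA.
apply: mu_subU; [exact: symd_meas|exact: symd_meas|exact: symd_meas|].
move=> x; rewrite /symd /=.
by have [Bx|nBx] := pselect (B x); tauto.
Qed.

End ProductSums.

(** * Dyadic sublevel sets *)

Section Dyadic.
Context (R : realType).

Lemma dyadic01_1 : dyadic01 (1 : R).
Proof. by exists 1%N, 0%N; rewrite expr0 divr1. Qed.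

Lemma dyadic01_dense (y z : R) : 0 <= y -> y < z -> y < 1 ->
  exists q, [/\ dyadic01 q, y < q & q <= z].
Proof.
move=> y0 yz y1; pose w := Num.min z 1; have yw : y < w by rewrite lt_min yz.
have [b be] : exists b : nat, b.+1%:R^-1 < w - y.
  have wy : 0 < w - y by rewrite subr_gt0.
  by have [n _ /(_ n (leqnn _))/=] := near_infty_natSinv_lt (PosNum wy); exists n.
have p0 : 0 < 2 ^+ b :> R by rewrite exprn_gt0.
have b2 : 1 < (w - y) * 2 ^+ b.
  rewrite -ltr_pdivrMr// div1r; apply: le_lt_trans be.
  by rewrite lef_pV2 ?posrE// -natrX ler_nat ltn_expl.
(* The least multiple of [2 ^- b] exceeding [y]; the minimum with 1 in [w] keeps it in [0,1]. *)
pose a := (Num.trunc (y * 2 ^+ b)).+1.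
have ay : y * 2 ^+ b < a%:R by exact: truncnS_gt.
have aw : a%:R < w * 2 ^+ b.
  rewrite /a -natr1; have /andP[+ _] := truncn_itv (mulr_ge0 y0 (ltW p0)).
  rewrite -(lerD2r 1) => /le_lt_trans; apply.
  by rewrite -ltrBrDl -mulrBl.
have qw : a%:R / 2 ^+ b <= w by rewrite ler_pdivrMr// ltW.
exists (a%:R / 2 ^+ b); split.
- exists a, b; split=> //; rewrite -(ler_nat R) natrX.
  by rewrite -[leRHS]mul1r -ler_pdivrMr// (le_trans qw)// ge_min lexx orbT.
- by rewrite ltr_pdivlMr.
- by rewrite (le_trans qw)// ge_min lexx.
Qed.

Definition dyadic_enum (n : nat) : R :=
  if unpickle n is Some (a, b) then
    if (a <= 2 ^ b)%N then a%:R / 2 ^+ b else 1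
  else 1.

Lemma dyadic_enumP n : dyadic01 (dyadic_enum n).
Proof.
rewrite /dyadic_enum; case: unpickle => [[a b]|]; last exact: dyadic01_1.
by case: ifP => ab; [exists a, b|exact: dyadic01_1].
Qed.

Lemma dyadic_enum_surj q : dyadic01 q -> exists n, q = dyadic_enum n.
Proof.
move=> [a [b [ab ->]]]; exists (pickle (a, b)).
by rewrite /dyadic_enum pickleK ab.
Qed.

(** Recovers a value from its dyadic strict upper bounds; the default 1 covers [y = 1], where there
    are none. *)
Lemma inf_dyadic (y : R) : 0 <= y <= 1 ->
  infs (fun n => if y < dyadic_enum n then dyadic_enum n else 1) 0%N = y.
Proof.
move=> /andP[y0 y1]; pose h n : R := if y < dyadic_enum n then dyadic_enum n else 1.
rewrite -[LHS]/(inf (sdrop h 0%N)); set S := sdrop h 0%N.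
have lb : lbound S y.
  by move=> _ [n _ <-]; rewrite /h; case: ifP => // /ltW.
have S_inf : has_inf S by split; [exists (h 0%N), 0%N|exists y].
apply/eqP; rewrite eq_le lb_le_inf ?andbT//; last by case: S_inf.
apply/ler_addgt0Pr => e e0.
have [y_lt1|y_ge1] := ltP y 1; last first.
  apply: (@le_trans _ _ (h 0%N)); first by apply: ge_inf; [case: S_inf|exists 0%N].
  rewrite /h; case: ifP => _; last by rewrite (le_trans y_ge1)// lerDl ltW.
  have /andP[_ h1] := dyadic01_itv (dyadic_enumP 0).
  by rewrite (le_trans h1)// (le_trans y_ge1)// lerDl ltW.
have [|q [/dyadic_enum_surj[n ->] yq qe]] := @dyadic01_dense y (y + e) y0 _ y_lt1.
  by rewrite ltrDl.
apply: le_trans qe; apply: ge_inf; first by case: S_inf.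
by exists n => //; rewrite /h yq.
Qed.

End Dyadic.

Lemma measure_bigsetU_le d (T : measurableType d) (R : realType)
    (mu : {measure set T -> \bar R}) (I : Type) (s : seq I) (S : I -> set T) :
  (forall i, measurable (S i)) ->
  (mu (\big[setU/set0]_(i <- s) S i) <= \sum_(i <- s) mu (S i))%E.
Proof.
move=> mS; elim: s => [|i s IH]; first by rewrite !big_nil measure0.
rewrite !big_cons.
apply: (@le_trans _ _ (mu (S i) + mu (\big[setU/set0]_(j <- s) S j))%E).
  by apply: measureU2 => //; exact: bigsetU_measurable.
exact: leeD2l.
Qed.

(** * Almost everywhere measurability and the L2 approximation *)

Section Conclusion.
Context (R : realType) (k m : nat) (V : 'I_m -> pointedType).
Variable P : graded_probability R V.
Context (f : (forall i, V i) -> R).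
Context (f_meas : gen_measurable (gB P (@onesm m)) (f \o @btuple m V)).
Context (f01 : forall x, 0 <= f x <= 1).
Local Notation T1 := (bpow V (@onesm m)).
Local Notation mu := (gmu P (@onesm m)).
Context (f_low : forall q, dyadic01 q ->
  exists2 B, fib_salg f k B & aeq mu [set v | f (btuple v) < q] B).

(** Apply the formula of [inf_dyadic] to the sets [B n] in place of the sublevel sets; it returns
    [f] off a countable union of null sets. *)
Lemma ae_cylinder_measurable :
  gen_measurable_ae (cylinders P (@onesm m) k) mu (f \o @btuple m V).
Proof.
have [B hB] : exists B : (set T1)^nat, forall n, fib_salg f k (B n) /\
    aeq mu [set v | f (btuple v) < dyadic_enum R n] (B n).
  exists (fun n => projT1 (cid2 (f_low (dyadic_enumP R n)))) => n.
  by case: cid2.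
pose h n (x : T1) : R := if x \in B n then dyadic_enum R n else 1.
have h0 n x : 0 <= h n x.
  rewrite /h; case: ifP => _ //; by have /andP[] := dyadic01_itv (dyadic_enumP R n).
exists (fun x => infs (h ^~ x) 0%N).
  apply: measurable_fun_infs.
    by move=> x _; exists 0 => _ [n _ <-].
  move=> n.
  have mB : measurable (B n : set (g_sigma_algebraType (cylinders P (@onesm m) k))).
    have := (hB n).1; apply: sub_sigma_algebra2 => _ [J [u [q [Jk dq ->]]]].
    exact: fib_cylinder.
  have -> : h n = fun x => 1 + (dyadic_enum R n - 1) * \1_(B n) x.
    apply/funext => x; rewrite /h indicE; case: ifP => _.
      by rewrite mulr1 addrC subrK.
    by rewrite mulr0 addr0.
  by apply: measurable_funD => //; apply: measurable_funM.
apply: negligibleS (negligible_bigcup (fun n => (hB n).2)) => x /= ne.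
apply: contrapT => nx; apply: ne.
rewrite -[LHS](inf_dyadic (f01 (btuple x))); congr (infs _ _); apply/funext => n.
rewrite /h; have [xB|xB] := pselect (B n x).
  rewrite mem_set//; case: ifP => // /negP fx.
  by exfalso; apply: nx; exists n => //; right.
rewrite memNset//; case: ifP => // fx.
by exfalso; apply: nx; exists n => //; left.
Qed.

(** The sum counts the multiples of [1 / M] in (0, y], that is, it equals the integer part of
    [y M]. *)
Lemma truncation_sum (M : nat) (y : R) : (0 < M)%N -> 0 <= y <= 1 ->
  `|y - M%:R^-1 * \sum_(j < M) (~~ (y < j.+1%:R / M%:R))%:R| <= M%:R^-1.
Proof.
move=> M0 /andP[y0 y1]; have M0' : 0 < M%:R :> R by rewrite ltr0n.
pose c := Num.trunc (y * M%:R).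
have yM : 0 <= y * M%:R by rewrite mulr_ge0// ltW.
have cM : (c <= M)%N.
  rewrite -(ler_nat R); have /andP[/le_trans + _] := truncn_itv yM; apply.
  by rewrite ler_piMl// ltW.
have -> : \sum_(j < M) (~~ (y < j.+1%:R / M%:R))%:R = c%:R :> R.
  rewrite (eq_bigr (fun j : 'I_M => (j < c)%N%:R)).
    rewrite -natr_sum; congr (_%:R).
    rewrite -[RHS]card_ord -sum1_card (big_ord_widen M (fun=> 1%N) cM).
    by rewrite [RHS]big_mkcond; apply: eq_bigr => j _; case: ltnP.
  move=> j _; rewrite -leNgt ler_pdivrMr// -truncn_ge_nat//.
have /andP[c1 c2] := truncn_itv yM.
have -> : y - M%:R^-1 * c%:R = (y * M%:R - c%:R) / M%:R.
  by rewrite mulrBl mulfK ?gt_eqF// mulrC.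
rewrite ger0_norm; last by rewrite divr_ge0 ?subr_ge0// ltW.
by rewrite ler_pdivrMr// mulVf ?gt_eqF// lerBlDl natr1 ltW.
Qed.

(** Truncate [f] at the levels [j.+1 / M] and replace each sublevel set by an elementary set [A j].
    Off the union [bad] of the differences the error is at most [1 / M], and on it at most 1. *)
Lemma L2_approximation (eps : R) : 0 < eps ->
  exists (N : nat) (gamma : 'I_N -> rat)
         (F : 'I_N -> forall I : {set 'I_m}, bpow V (indm I) -> R),
    let g := fun x : forall i, V i =>
      \sum_(i < N) ratr (gamma i) *
        \prod_(I : {set 'I_m} | (#|I| <= k)%N) F i I (brestr I x) in
    [/\ forall i, 0 <= gamma i <= 1,
        forall i (I : {set 'I_m}), (#|I| <= k)%N ->
          gen_measurable (fiber_sets f I) (F i I) /\ (forall x, 0 <= F i I x <= 1),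
        forall x, 0 <= g x <= 1 &
        ('N[mu]_2%:E
           [(fun x => (f (btuple x) - g (btuple x))%R%:E)] < eps%:E)%E].
Proof.
move=> eps0.
have [b be] : exists b : nat, (2 ^ b)%:R^-1 ^+ 2 < eps ^+ 2 / 2 :> R.
  have e2 : 0 < eps / 2 by rewrite divr_gt0.
  have [n ne] : exists n : nat, n.+1%:R^-1 < eps / 2.
    by have [n _ /(_ n (leqnn _))/=] := near_infty_natSinv_lt (PosNum e2); exists n.
  exists n; apply: (@le_lt_trans _ _ ((eps / 2) ^+ 2)).
    rewrite ler_pXn2r ?nnegrE ?invr_ge0 ?ler0n ?(ltW e2)//.
    apply: ltW; apply: le_lt_trans ne.
    by rewrite lef_pV2 ?posrE ?ltr0n ?expn_gt0// ler_nat ltn_expl.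
  by rewrite expr_div_n ltr_pM2l ?exprn_gt0// ltf_pV2 ?posrE ?exprn_gt0// -natrX ltr_nat.
pose M := (2 ^ b)%N; have M0 : (0 < M)%N by rewrite expn_gt0.
have M0' : 0 < M%:R :> R by rewrite ltr0n.
pose L (j : 'I_M) : set T1 := [set v | f (btuple v) < j.+1%:R / M%:R].
have dy (j : 'I_M) : dyadic01 (j.+1%:R / M%:R : R).
  by exists j.+1, b; rewrite -natrX; split => //; exact: ltn_ord.
(* The [M] exceptional sets then have total measure at most [eps ^+ 2 / 2]. *)
pose eta : R := eps ^+ 2 / 2 / M%:R.
have eta0 : 0 < eta by rewrite !divr_gt0// exprn_gt0.
have mL j : gB P _ (L j) by rewrite /L -(fib_setT f point); exact: fib_meas.
have hA j : exists A, elementary k f A /\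
    (mu ((L j `\` A) `|` (A `\` L j)) < eta%:E)%E.
  have [B kB LB] := f_low (dy j).
  by have [A eA LA] := aeq_approximable f_meas (mL j) kB LB eta0; exists A.
pose A j := projT1 (cid (hA j)).
have eA j : elementary k f (A j) by rewrite /A; case: cid => ? [].
have muA j : (mu ((L j `\` A j) `|` (A j `\` L j)) < eta%:E)%E.
  by rewrite /A; case: cid => ? [].
have [Q [F [Fm FE]]] := sum_of_products_sum
  (phi := fun j : 'I_M => \1_(~` A j) : T1 -> R)
  (fun j => let: And3 _ _ h := eA j in h).
exists #|Q|, (fun=> M%:R^-1), (fun i => F (enum_val i)) => g.
have gE (x : T1) : g (btuple x) = M%:R^-1 * \sum_(j < M) \1_(~` A j) x.
  rewrite FE mulr_sumr /g (big_enum_val (A := Q) (fun q => _ * family_prod k (F q) _)).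
  by apply: eq_bigr => i _; rewrite fmorphV rmorph_nat.
have g01 (x : T1) : 0 <= g (btuple x) <= 1.
  rewrite gE mulr_ge0 ?invr_ge0 ?(ltW M0') ?sumr_ge0//= ler_pdivrMl// mulr1.
  apply: (@le_trans _ _ (\sum_(j < M) 1)); last by rewrite sumr_const card_ord.
  apply: ler_sum => j _.
  by rewrite indicE lern1 leq_b1.
split.
- by move=> i; rewrite invr_ge0 ler0n invf_le1 ?ltr0n// ler1n.
- by move=> i I Ik; exact: Fm.
- by move=> x; exact: (g01 (fun i _ => x i)).
pose S j : set (g_sigma_algebraType (gB P (@onesm m))) :=
  (L j `\` A j) `|` (A j `\` L j).
pose bad := \big[setU/set0]_(j < M) S j.
have mA j : gB P _ (A j) by exact: elementary_meas (eA j).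
have mS j : measurable (S j).
  by apply: measurableU; apply: measurableD; rewrite gB_measurable.
have mbad : measurable bad by apply: bigsetU_measurable.
have mubad : (mu bad <= (eps ^+ 2 / 2)%:E)%E.
  apply: (le_trans (measure_bigsetU_le mu _ mS)).
  apply: (@le_trans _ _ (\sum_(j < M) eta%:E)%E).
    by apply: lee_sum => j _; exact/ltW/muA.
  rewrite sumEFin lee_fin sumr_const card_ord -(mulr_natr eta) /eta divfK//.
  by rewrite gt_eqF.
have fg_bad (x : T1) : (f (btuple x) - g (btuple x)) ^+ 2 <= M%:R^-1 ^+ 2 + \1_bad x.
  rewrite -real_normK ?num_real// indicE.
  have [xb|xb] := pselect (bad x).
    rewrite mem_set// -[leLHS]add0r lerD ?exprn_ge0 ?invr_ge0 ?ler0n//.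
    rewrite exprn_ile1// ler_norml.
    have /andP[f0 f1] := f01 (btuple x); have /andP[g0 g1] := g01 x.
    apply/andP; split; first by rewrite lerBrDl (le_trans _ f0)// subr_le0.
    by rewrite lerBlDl (le_trans f1)// lerDr.
  rewrite memNset// addr0 ler_pXn2r ?nnegrE ?invr_ge0 ?ler0n// gE.
  have := truncation_sum M0 (f01 (btuple x)); congr (`|_ - _ * _| <= _).
  apply: eq_bigr => j _; rewrite indicE; congr (nat_of_bool _)%:R.
  have nS : ~ S j x by move=> Sx; apply: xb; rewrite /bad (bigD1 j)//=; left.
  apply/idP/idP; rewrite inE /= => H.
    move=> Ax; apply: nS; right; split=> //; exact/negP.
  by apply/negP => Lx; apply: nS; left.
have mfg : measurable_fun setT
    (fun x : g_sigma_algebraType (gB P (@onesm m)) =>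
      (f (btuple x) - g (btuple x)) ^+ 2).
  apply: measurable_funX; apply: measurable_funB; first exact: f_meas.
  rewrite (_ : (fun x => g (btuple x)) =
    fun x : T1 => M%:R^-1 * \sum_(j < M) \1_(~` A j) x); last exact/funext.
  apply: measurable_funM => //; apply: measurable_sum => j.
  by apply: measurable_indic; apply: measurableC; rewrite gB_measurable.
have m1 : measurable_fun setT
    (fun x : g_sigma_algebraType (gB P (@onesm m)) => (\1_bad x : R)%:E).
  by apply/measurable_EFinP; exact: measurable_indic.
(* Squaring turns the claim into a bound on an integral; the two halves of [eps ^+ 2] pay for
   truncation and for [bad], the first one strictly. *)
rewrite ltNge; apply/negP => eN.
have : (eps%:E `^ 2 <= 'N[mu]_2%:E
   [(fun x => (f (btuple x) - g (btuple x))%R%:E)] `^ 2)%E.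
  apply: gt0_ler_poweR => //; rewrite in_itv /= leey andbT.
    by rewrite lee_fin ltW.
  exact: Lnorm_ge0.
rewrite powR_Lnorm//; apply/negP; rewrite -ltNge.
apply: (@le_lt_trans _ _ (\int[mu]_x ((M%:R^-1 ^+ 2)%:E + (\1_bad x)%:E))%E).
  under eq_integral => x _ do rewrite /= powR_mulrn// real_normK ?num_real//.
  apply: ge0_le_integral => //.
  - by move=> x _; rewrite lee_fin sqr_ge0.
  - exact/measurable_EFinP.
  - by apply: emeasurable_funD.
  - by move=> x _; rewrite lee_fin.
rewrite ge0_integralD//.
rewrite integral_cst//= probability_setT mule1 integral_indic// setIT.
rewrite powR_mulrn ?ltW// [eps ^+ 2]splitr EFinD.
by apply: lte_leD; rewrite ?lte_fin ?fin_num_measure.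
Qed.

End Conclusion.

Unset Implicit Arguments.

Theorem theorem6p5 (R : realType) (k k' : nat) (k_ge1 : (1 <= k)%N) (k_lt : (k < k')%N)
    (V : 'I_k' -> pointedType) (P : graded_probability R V)
    (f : (forall i, V i) -> R)
    (f01 : forall x, 0 <= f x <= 1)
    (f_meas : gen_measurable (gB P (@onesm k')) (f \o @btuple k' V))
    (f_VC : VC_finite k f) :
  gen_measurable_ae (cylinders P (@onesm k') k) (gmu P (@onesm k')) (f \o @btuple k' V)
  /\
  forall eps : R, 0 < eps ->
  exists (N : nat) (gamma : 'I_N -> rat)
         (F : 'I_N -> forall I : {set 'I_k'}, bpow V (indm I) -> R),
    let g := fun x : forall i, V i =>
      \sum_(i < N) ratr (gamma i) *
        \prod_(I : {set 'I_k'} | (#|I| <= k)%N) F i I (brestr I x) in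
    [/\ forall i, 0 <= gamma i <= 1,
        forall i (I : {set 'I_k'}), (#|I| <= k)%N ->
          gen_measurable (fiber_sets f I) (F i I) /\ (forall x, 0 <= F i I x <= 1),
        forall x, 0 <= g x <= 1 &
        ('N[gmu P (@onesm k')]_2%:E
           [(fun x => (f (btuple x) - g (btuple x))%R%:E)] < eps%:E)%E].
Proof.
have [d f_VC_d] := f_VC.
have f_low q (dq : dyadic01 q) := sublevel_lower f_meas f01 f_VC_d dq.
split; first exact: ae_cylinder_measurable.
exact: L2_approximation.
Qed.
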